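(* Suppose that (W* ) the cost function $c$ is $\mathbb{K}$-inf-compact on $\mathbb{X}\times\mathbb{A}$, and the transition probability $q(\cdot|x,a)$ is weakly continuous in $(x,a)\in\mathbb{X}\times\mathbb{A}$; and that for a sequence $\{\alpha_n\}_{n\ge1}\subset[0,1)$ with $\alpha_n\uparrow1$, ($\underline{B}_{\{\alpha_n\}}$) $w^*:=\inf_{x\in\mathbb{X}}w(x)<+\infty$ and $\liminf_{n\to\infty}u_{\alpha_n}(x)<+\infty$ for all $x\in\mathbb{X}$. Let $$u(x):=\liminf_{n\to\infty,\;y\to x}u_{\alpha_n}(y),\qquad x\in\mathbb{X}.$$ Then there exists a deterministic policy $\phi$ such that $$c(x,\phi(x))+\int_{\mathbb{X}}u(y)\,q(dy|x,\phi(x))\le\overline{w}+u(x),\qquad x\in\mathbb{X}.$$ Therefore, $\phi$ is a deterministic average-cost optimal policy. In addition, the function $u$ is lower semi-continuous, and for each $x\in\mathbb{X}$ $$w(x)=w^{\phi}(x)=\limsup_{n\to\infty}(1-\alpha_n)v_{\alpha_n}(x)=\limsup_{\alpha\uparrow 1}(1-\alpha)v_{\alpha}(x)=\overline{w}=\overline{w}_{\{\alpha_n\}}=w^*.$$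
   Context: Setting (MDP). The state space $\mathbb{X}$ and the action space $\mathbb{A}$ are Borel subsets of Polish spaces; every action in $\mathbb{A}$ is available at every state. The one-step cost $c:\mathbb{X}\times\mathbb{A}\to\mathbb{R}\cup\{+\infty\}$ is measurable and bounded below. The transition kernel $q(B|x,a)$ ($B\in\mathcal{B}(\mathbb{X})$) is a regular (measurable) transition probability from $\mathbb{X}\times\mathbb{A}$ to $\mathbb{X}$. A policy $\pi=(\pi_0,\pi_1,\dots)$ is a sequence of decision rules, $\pi_t$ being a regular transition probability from the histories $(\mathbb{X}\times\mathbb{A})^t\times\mathbb{X}$ to $\mathbb{A}$; $\Pi$ is the set of all policies. A deterministic policy is identified with a measurable map $\phi:\mathbb{X}\to\mathbb{A}$, which prescribes action $\phi(x)$ whenever the current state is $x$. For an initial state $x$ and policy $\pi$, $\mathbb{E}_x^\pi$ is the expectation with respect to the induced probability measure on trajectories $(x_0,a_0,x_1,a_1,\dots)$ (Ionescu Tulcea theorem). Criteria. $v_{N,\alpha}^\pi(x)=\mathbb{E}_x^\pi\sum_{t=0}^{N-1}\alpha^t c(x_t,a_t)$ for $N\in\{1,2,\dots\}$, $\alpha\in[0,1]$; $v_\alpha^\pi(x)=\mathbb{E}_x^\pi\sum_{t=0}^{\infty}\alpha^t c(x_t,a_t)$ for $\alpha\in[0,1)$; $v_\alpha(x)=\inf_{\pi\in\Pi}v_\alpha^\pi(x)$; $w^\pi(x)=\limsup_{N\to\infty}\frac1N v_{N,1}^\pi(x)$; $w(x)=\inf_{\pi\in\Pi}w^\pi(x)$.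 A policy $\pi$ is average-cost optimal if $w^\pi(x)=w(x)$ for all $x\in\mathbb{X}$. Notation. $m_\alpha=\inf_{x\in\mathbb{X}}v_\alpha(x)$ (finite for all $\alpha\in[0,1)$ when $w^*<+\infty$), $u_\alpha(x)=v_\alpha(x)-m_\alpha$, $\overline{w}=\limsup_{\alpha\uparrow1}(1-\alpha)m_\alpha$, and for a sequence $\alpha_n\uparrow1$, $\overline{w}_{\{\alpha_n\}}=\limsup_{n\to\infty}(1-\alpha_n)m_{\alpha_n}$. Furthermore, $\liminf_{n\to\infty,\,y\to x}u_{\alpha_n}(y)=\sup_{m\ge1,\,R>0}\ \inf_{n\ge m,\,y\in B_R(x)}u_{\alpha_n}(y)$, where $B_R(x)$ is the open ball in $\mathbb{X}$ of radius $R$ centered at $x$ (so $y=x$ is allowed). Definitions. A function $f:\mathbb{U}\to\mathbb{R}\cup\{+\infty\}$ on a metric space $\mathbb{U}$ is inf-compact if for every $\lambda\in\mathbb{R}$ the level set $\{s\in\mathbb{U}:f(s)\le\lambda\}$ is compact. A function $f:\mathbb{X}\times\mathbb{A}\to\mathbb{R}\cup\{+\infty\}$ is $\mathbb{K}$-inf-compact if for every nonempty compact $\mathcal{K}\subset\mathbb{X}$ the restriction of $f$ to $\mathcal{K}\times\mathbb{A}$ is inf-compact. *)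

(* Defs.v *)
From HB Require Import structures.
From mathcomp Require Import all_boot all_order all_algebra.
From mathcomp Require Import all_classical all_reals all_analysis.
From mathcomp Require Import measurable_realfun.

Set Implicit Arguments.
Unset Strict Implicit.
Unset Printing Implicit Defensive.

Import Order.TTheory GRing.Theory Num.Theory.
Import numFieldNormedType.Exports.

Local Open Scope classical_set_scope.
Local Open Scope ring_scope.
Local Open Scope ereal_scope.

#[short(type="measurableMetricType")]
HB.structure Definition MeasurableMetric (R : realType) (d : measure_display) :=
  {T of Measurable d T & Metric R T}.

(* A Hausdorff pseudometric space is metric. *)
Definition polish (R : realType) (P : completePseudoMetricType R) : Prop :=
  hausdorff_space P /\ exists2 S : set P, countable S & dense S.

(* X carries its Borel sigma-algebra and is homeomorphic to a Borel subset of a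
   Polish space; the metric of X may be any metric compatible with the
   subspace topology. *)
Definition borel_subset_of_polish (R : realType) (d : measure_display)
    (X : measurableMetricType R d) : Prop :=
  (measurable : set (set X)) = <<s open >> /\
  exists (P : completePseudoMetricType R) (i : X -> P),
    [/\ polish P,
        injective i,
        (forall U : set X, open U <-> exists2 V, open V & U = i @^-1` V)
      & <<s open >> (range i)].

Definition inf_compact_on (R : realType) (U : topologicalType) (D : set U)
    (f : U -> \bar R) : Prop :=
  forall r : R, compact (D `&` [set s | f s <= r%:E]).

Definition K_inf_compact (R : realType) (X A : topologicalType)
    (f : X * A -> \bar R) : Prop :=
  forall K : set X, K !=set0 -> compact K -> inf_compact_on (K `*` setT) f.

(* liminf of f_n(y) as n -> oo and y -> x, the value y = x being allowed *)
Definition liminf_nbhs (R : realType) (X : metricType R)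
    (f : nat -> X -> \bar R) (x : X) : \bar R :=
  ereal_sup [set ereal_inf [set f nz.1 nz.2 | nz in
                              [set nz | (mr.1 <= nz.1)%N /\ ball x mr.2 nz.2]]
            | mr in [set mr : nat * R | (0 < mr.2)%R]].

Section mdp.
Context (R : realType) (dX dA : measure_display).
Context (X : measurableMetricType R dX) (A : measurableMetricType R dA).

Definition weakly_continuous (q : R.-pker (X * A)%type ~> X) : Prop :=
  forall f : X -> R, continuous f -> (exists M : R, forall y, `|f y| <= M)%R ->
    continuous (fun z : X * A => (\int[q z]_y f y)%R).

(* (x_0, a_0, ..., x_(t-1), a_(t-1)) together with the current state x_t *)
Definition history (t : nat) := (t.-tuple (X * A) * X)%type.

Definition policy := forall t : nat, R.-pker (history t) ~> A.

Definition det_policy (phi : {mfun X >-> A}) : policy := fun t =>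
  kdirac (measurableT_comp (measurable_funPT phi) (@measurable_snd _ _ _ _)
    : measurable_fun setT (fun h : history t => phi h.2)).

Definition coordinate_events : set (set (nat -> X * A)) :=
  \bigcup_t preimage_set_system setT
    (fun om : nat -> X * A => om t) measurable.

Definition trajectory := g_sigma_algebraType coordinate_events.

Definition past (t : nat) (om : trajectory) : t.-tuple (X * A) :=
  [tuple om i | i < t].

Definition history_of (t : nat) (om : trajectory) : history t :=
  (past t om, (om t).1).

(* The defining property of the probability induced by x and pi: x_0 = x, the
   conditional law of a_t given the history is pi_t, and that of x_(t+1) given
   (x_0, a_0, ..., x_t, a_t) is q(.|x_t, a_t). *)
Definition induced_by (q : R.-pker (X * A)%type ~> X) (pi : policy) (x : X)
    (P : probability trajectory R) : Prop :=
  [/\ (forall B : set X, measurable B -> P [set om | B (om 0%N).1] = \d_x B),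
      (forall t (B : set (history t)) (C : set A), measurable B -> measurable C ->
         P (history_of t @^-1` B `&` [set om | C (om t).2]) =
         \int[P]_(om in history_of t @^-1` B) pi t (history_of t om) C)
    & (forall t (B : set (t.+1.-tuple (X * A))) (C : set X),
         measurable B -> measurable C ->
         P (past t.+1 @^-1` B `&` [set om | C (om t.+1).1]) =
         \int[P]_(om in past t.+1 @^-1` B) q (om t) C)].

(* By the Ionescu Tulcea theorem exactly one probability is induced by q, pi
   and x, so that get returns it. *)
Definition traj_prob (q : R.-pker (X * A)%type ~> X) (pi : policy) (x : X) :
  probability trajectory R := get [set P | induced_by q pi x P].

Context (c : X * A -> \bar R) (q : R.-pker (X * A)%type ~> X).

Definition cost_N (N : nat) (alpha : R) (pi : policy) (x : X) : \bar R :=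
  \int[traj_prob q pi x]_om \sum_(t < N) (alpha ^+ t)%:E * c (om t).

Definition cost_disc (alpha : R) (pi : policy) (x : X) : \bar R :=
  \int[traj_prob q pi x]_om \sum_(0 <= t <oo) (alpha ^+ t)%:E * c (om t).

Definition value_disc (alpha : R) (x : X) : \bar R :=
  ereal_inf [set cost_disc alpha pi x | pi in [set: policy]].

Definition cost_avg (pi : policy) (x : X) : \bar R :=
  limn_esup (fun N : nat => (N%:R^-1)%:E * cost_N N 1%R pi x).

Definition value_avg (x : X) : \bar R :=
  ereal_inf [set cost_avg pi x | pi in [set: policy]].

Definition average_optimal (pi : policy) : Prop :=
  forall x, cost_avg pi x = value_avg x.

Definition w_star : \bar R := ereal_inf (range value_avg).

Definition m_disc (alpha : R) : \bar R := ereal_inf (range (value_disc alpha)).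

(* m_disc alpha is finite whenever w_star < +oo and 0 <= alpha < 1. *)
Definition u_disc (alpha : R) (x : X) : \bar R :=
  value_disc alpha x - m_disc alpha.

Definition w_bar : \bar R :=
  limf_esup (fun alpha : R => (1 - alpha)%:E * m_disc alpha) (1%R : R)^'-.

Definition w_bar_seq (alpha : nat -> R) : \bar R :=
  limn_esup (fun n => (1 - alpha n)%:E * m_disc (alpha n)).

Definition u_lim (alpha : nat -> R) : X -> \bar R :=
  liminf_nbhs (fun n => u_disc (alpha n)).

End mdp.

(* Main.v *)
Require Import Defs.
From HB Require Import structures.
From mathcomp Require Import all_boot all_order all_algebra.
From mathcomp Require Import all_classical all_reals all_analysis.
From mathcomp Require Import measurable_realfun ring lra zify.

Set Implicit Arguments.
Unset Strict Implicit.
Unset Printing Implicit Defensive.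

Import Order.TTheory GRing.Theory Num.Theory.
Import numFieldNormedType.Exports.

Local Open Scope classical_set_scope.
Local Open Scope ring_scope.
Local Open Scope ereal_scope.

(** Adding a constant to the cost moves every value function by an explicit
constant and leaves the functions u_alpha = v_alpha - m_alpha unchanged, so the
cost may be taken nonnegative. All the quantities in the conclusion are then
caught in the circle

  w_bar_seq <= w_bar <= limsup (1 - alpha) v_alpha(x) <= w(x) <= w^phi(x) <= w_bar_seq,

with the limit superior along the sequence also above w_bar_seq and below the
full one. The first two inequalities and w(x) <= w^phi(x) are immediate.

The third one is Tauberian and holds for each policy: if the partial sums of the
expected costs grow at most like C + s N, Abel summation bounds (1 - alpha) times
the discounted cost by (1 - alpha) C + s [limsup_value_disc_le_avg].

The last one needs the policy phi. Value iteration shows that v_alpha is lower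
semicontinuous and that some action satisfies
c(y,a) + alpha \int u_alpha dq(.|y,a) <= (1 - alpha) m_alpha + u_alpha(y)
[value_discE, discounted_optimality]. Choose n_k >= k and y_k -> x such that
u_(alpha_(n_k))(y_k) tends to u(x), with such actions a_k. The costs c(y_k,a_k) are
bounded, so K-inf-compactness makes the a_k accumulate at some a, and a Fatou
lemma for weakly converging measures and varying integrands yields
c(x,a) + \int u dq(.|x,a) <= w_bar_seq + u(x) [near_minimizers_limit,
average_optimality_point]. The actions with this property form a nonempty compact
set depending measurably on x, hence have a measurable selector phi
[measurable_selector]. Summing the inequality along the trajectory of phi, where
u >= 0 telescopes, bounds the average cost of phi by w_bar_seq
[cost_avg_le_w_bar_seq].

Expectations only make sense once the trajectory law exists; this is the
Ionescu Tulcea theorem, proved for a sequence of kernels that redraw one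
coordinate each [ionescu_tulcea, traj_prob_induced]. The Fatou lemma comes from
Lipschitz envelopes, which are bounded continuous functions increasing to the
joint lower limit [liminf_nbhs_envelope, weak_fatou]. *)

(** * Kernels and laws *)

Section kernel_composition.
Context d0 d1 d2 (T0 : measurableType d0) (T1 : measurableType d1)
  (T2 : measurableType d2) (R : realType).

Lemma ge0_integral_kcomp_noparam (k1 : R.-pker T0 ~> T1)
    (k2 : R.-spker T1 ~> T2) x (f : T2 -> \bar R) :
  (forall y, 0 <= f y) -> measurable_fun setT f ->
  \int[mkcomp_noparam k1 k2 x]_y f y = \int[k1 x]_y \int[k2 y]_z f z.
Proof.
move=> f0 mf.
exact: (integral_kcomp k1 (kernel.kernel_snd k2)).
Qed.

End kernel_composition.

Lemma eq_integral_law d1 d2 d (T1 : measurableType d1) (T2 : measurableType d2)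
    (Y : measurableType d) (R : realType) (m1 : {measure set T1 -> \bar R})
    (m2 : {measure set T2 -> \bar R}) (f1 : T1 -> Y) (f2 : T2 -> Y) (g : Y -> \bar R) :
  measurable_fun setT f1 -> measurable_fun setT f2 ->
  (forall B, measurable B -> m1 (f1 @^-1` B) = m2 (f2 @^-1` B)) ->
  measurable_fun setT g -> (forall y, 0 <= g y) ->
  \int[m1]_x g (f1 x) = \int[m2]_x g (f2 x).
Proof.
move=> mf1 mf2 m12 mg g0.
transitivity (\int[pushforward m1 f1]_y g y).
  by rewrite [RHS]ge0_integral_pushforward// preimage_setT.
transitivity (\int[pushforward m2 f2]_y g y); last first.
  by rewrite [LHS]ge0_integral_pushforward// preimage_setT.
by apply: eq_measure_integral => B mB _; exact: m12.
Qed.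

Section kernel_probability.
Context d0 d1 (T0 : measurableType d0) (T1 : measurableType d1) (R : realType).
Variables (k : R.-pker T0 ~> T1) (x : T0).

(** A name for [k x] to which the structure of a probability can be attached. *)
Definition kernel_at : set T1 -> \bar R := k x.

HB.instance Definition _ := Measure.on kernel_at.

HB.instance Definition _ :=
  Measure_isProbability.Build _ _ _ kernel_at (prob_kernel x).

End kernel_probability.

Section mean_value.
Context d (T : measurableType d) (R : realType).

Lemma integral_prob_cst (P : probability T R) (r : \bar R) : \int[P]_y r = r.
Proof.
rewrite integral_cst//.
exact: (etrans (congr1 (mule r) (probability_setT P)) (mule1 r)).
Qed.

(** Otherwise e - h would be positive everywhere with integral 0. *)
Lemma ge_integral_ex (P : probability T R) (h : T -> \bar R) (e : R) :
  (forall y, 0 <= h y) -> measurable_fun setT h ->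
  e%:E <= \int[P]_y h y -> exists y, e%:E <= h y.
Proof.
move=> h0 mh eh; apply: contrapT => /forallNP he.
have {}he y : h y < e%:E by rewrite ltNge; apply/negP.
have hfin y : h y \is a fin_num.
  by rewrite ge0_fin_numE// (lt_le_trans (he y))// leey.
have ilt : \int[P]_y h y < +oo.
  apply: (@le_lt_trans _ _ (\int[P]_y e%:E)).
    by apply: ge0_le_integral => // y _; exact: ltW.
  by rewrite integral_prob_cst ltry.
have : \int[P]_y (e%:E - h y) = 0.
  have := @integralB _ _ _ P setT measurableT (cst e%:E) h.
  rewrite /= => ->//.
  - rewrite integral_prob_cst.
    apply/eqP; rewrite eq_le; apply/andP; split.
      by rewrite leeBlDr ?add0e// ge0_fin_numE// integral_ge0.
    rewrite sube_ge0; last first.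
      by rewrite ge0_fin_numE ?integral_ge0// ilt.
      apply: (@le_trans _ _ (\int[P]_y e%:E)).
        by apply: ge0_le_integral => // y _; exact: ltW.
      by rewrite integral_prob_cst.
  - exact: (finite_measure_integrable_cst P e measurableT).
  - apply/integrableP; split => //.
    by under eq_integral do rewrite gee0_abs//.
move=> int0.
have mB : measurable_fun setT (fun y => e%:E - h y) by exact: emeasurable_funB.
have [+ _] := @ae_eq_integral_abs _ _ _ P setT measurableT _ mB.
rewrite (eq_integral (fun y => e%:E - h y)); last first.
  by move=> y _; rewrite gee0_abs// sube_ge0 ?ltW// hfin.
move=> /(_ int0) [N [mN N0 sN]].
have : P setT <= P N.
  apply: le_measure; rewrite ?inE// => y _; apply: sN => /= /(_ I)/eqP.
  rewrite sube_eq ?add0e// => /eqP eqe.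
  by move: (he y); rewrite eqe ltxx.
by rewrite N0 probability_setT lee_fin ler10.
Qed.

End mean_value.

(** * The Ionescu Tulcea extension theorem *)

(** Events decided by the first s coordinates. The relation of having the same
first s coordinates is a parameter, so that the states and the actions of a
trajectory can be drawn as separate coordinates. *)
Definition agreement_cylinder d (T : measurableType d) (agree : nat -> T -> T -> Prop)
    (s : nat) (S : set T) : Prop :=
  measurable S /\ forall w w', agree s w w' -> S w -> S w'.

Section ionescu_tulcea.
Context d (T : measurableType d) (R : realType).
Variables (agree : nat -> T -> T -> Prop) (K : nat -> R.-pker T ~> T) (w0 : T).
Notation cyl := (agreement_cylinder agree).

Hypothesis agree_sym : forall s w w', agree s w w' -> agree s w' w.
Hypothesis agree_le : forall s s' w w', (s <= s')%N -> agree s' w w' -> agree s w w'.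
Hypothesis agree_lim : forall f : nat -> T,
  (forall s, agree s (f s) (f s.+1)) -> exists w, forall s, agree s (f s) w.
(* K s redraws coordinate s: it changes no earlier coordinate, its law is a
   function of the earlier ones, and it charges only points that agree with w. *)
Hypothesis K_cyl : forall s r S w, (s <= r)%N -> cyl s S -> K r w S = \d_w S.
Hypothesis K_cylS : forall s S w w', cyl s.+1 S -> agree s w w' ->
  K s w S = K s w' S.
Hypothesis K_ex : forall s w (h : T -> \bar R) (e : R), measurable_fun setT h ->
  (forall y, 0 <= h y) ->
  e%:E <= \int[K s w]_y h y -> exists2 w', agree s w w' & e%:E <= h w'.

(** Draws the coordinates n, ..., n + j - 1 in turn. The recursion is on the first
of them, as the choice of a point coordinate by coordinate requires;
[resample_recr] is the recursion on the last one. *)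
Fixpoint resample (n j : nat) : R.-spker T ~> T :=
  if j is j'.+1 then mkcomp_noparam (K n) (resample n.+1 j')
  else kdirac (@measurable_id _ T setT).

Lemma resample_recr n j w S : measurable S ->
  resample n j.+1 w S = \int[resample n j w]_w' K (n + j)%N w' S.
Proof.
move=> mS.
have mK m : measurable_fun setT ((K m)^~ S) by exact: measurable_kernel.
elim: j n w => [|j IH] n w.
  rewrite /= /mkcomp_noparam /kcomp_noparam /=.
  rewrite [RHS]integral_dirac// diracT mul1e addn0.
  under eq_integral do rewrite /kdirac /=.
  rewrite -[in RHS](setIT S) -integral_indic//.
transitivity (\int[K n w]_w' resample n.+1 j.+1 w' S); first by [].
under eq_integral do rewrite IH.
by rewrite /= ge0_integral_kcomp_noparam// addnS.
Qed.

Lemma resampleT n j w : resample n j w setT = 1.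
Proof.
elim: j n w => [|j IH] n w; first by rewrite /= /kdirac /= diracT.
transitivity (\int[K n w]_w' resample n.+1 j w' setT); first by [].
under eq_integral do rewrite IH.
by rewrite integral_cst// mul1e prob_kernel.
Qed.

(** Coordinate n + j is too late to matter for an event decided by the first s. *)
Lemma resample_stable s n j w S : cyl s S -> (s <= n + j)%N ->
  resample n j.+1 w S = resample n j w S.
Proof.
move=> cS sj; rewrite resample_recr; last by case: cS.
under eq_integral => w' _ do rewrite (K_cyl w' sj cS).
rewrite -[in RHS](setIT S) -integral_indic//.
by case: cS.
Qed.

Lemma resample_stable_le s n i j w S : cyl s S -> (s <= n + i)%N -> (i <= j)%N ->
  resample n j w S = resample n i w S.
Proof.
move=> cS si; elim: j => [|j IH].
  by rewrite leqn0 => /eqP ->.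
rewrite leq_eqVlt => /predU1P[<-//|]; rewrite ltnS => ij.
rewrite (resample_stable _ cS) ?IH//.
by rewrite (leq_trans si)// leq_add2l.
Qed.

Lemma cyl_le s s' S : (s <= s')%N -> cyl s S -> cyl s' S.
Proof. by move=> ss' [mS iS]; split => // w w' /(agree_le ss'); exact: iS. Qed.

Lemma cylU s S S' : cyl s S -> cyl s S' -> cyl s (S `|` S').
Proof.
move=> [mS iS] [mS' iS']; split; first exact: measurableU.
by move=> w w' ww' [/(iS _ _ ww')|/(iS' _ _ ww')]; [left|right].
Qed.

Lemma cylC s S : cyl s S -> cyl s (~` S).
Proof.
move=> [mS iS]; split; first exact: measurableC.
by move=> w w' ww' nS /(iS _ _ (agree_sym ww')).
Qed.

Lemma cyl0 s : cyl s set0.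
Proof. by split. Qed.

(** The conditional probability of an s-cylinder given the first n coordinates:
since n + (s - n) >= s, all the coordinates that decide it have been drawn. *)
Definition cyl_law (n s : nat) (w : T) (S : set T) := resample n (s - n) w S.

Lemma cyl_lawE n s j w S : cyl s S -> (s <= n + j)%N ->
  cyl_law n s w S = resample n j w S.
Proof.
move=> cS sj; rewrite /cyl_law (@resample_stable_le s n (s - n) j)//.
  by rewrite -leq_subLR.
by rewrite leq_subLR.
Qed.

Lemma cyl_law_step n s w S : cyl s S ->
  cyl_law n s w S = \int[K n w]_w' cyl_law n.+1 s w' S.
Proof.
move=> cS; rewrite (@cyl_lawE _ _ (s - n.+1).+1)//.
by rewrite addnS -addSn -leq_subLR.
Qed.

Lemma cyl_law_le1 n s w S : cyl s S -> cyl_law n s w S <= 1.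
Proof.
move=> cS; rewrite /cyl_law -(resampleT n (s - n) w).
by apply: le_measure; rewrite ?inE//; case: cS.
Qed.

Lemma cyl_law_measurable n s S : cyl s S -> measurable_fun setT ((cyl_law n s)^~ S).
Proof. by move=> [mS _]; exact: measurable_kernel. Qed.

(** By dominated convergence the infimum over k of the conditional laws still has
integral at least e with respect to coordinate n, so it is at least e somewhere. *)
Lemma cyl_law_nested n w (S : nat -> set T) (r : nat -> nat) (e : R) :
  (forall k, cyl (r k) (S k)) -> nonincreasing_seq S ->
  (forall k, e%:E <= cyl_law n (r k) w (S k)) ->
  exists2 w', agree n w w' & forall k, e%:E <= cyl_law n.+1 (r k) w' (S k).
Proof.
move=> cS ndS eS.
pose g k w' := cyl_law n.+1 (r k) w' (S k).
have g0 k w' : 0 <= g k w' by exact: measure_ge0.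
have gS w' : nonincreasing_seq (g^~ w').
  move=> i j ij; rewrite /g.
  have h := leq_maxl (r i) (r j); have h' := leq_maxr (r i) (r j).
  rewrite (@cyl_lawE _ _ (maxn (r i) (r j)))//; last by rewrite (leq_trans h')// leq_addl.
  rewrite (@cyl_lawE _ (r i) (maxn (r i) (r j)))//; last by rewrite (leq_trans h)// leq_addl.
  apply: le_measure; rewrite ?inE; first by case: (cS j).
    by case: (cS i).
  by move/subsetPset: (ndS _ _ ij).
have mg k : measurable_fun setT (g k) by exact: cyl_law_measurable.
pose h w' := ereal_inf (range (g^~ w')).
have gcvg w' : g^~ w' @ \oo --> h w'.
  exact: ereal_nonincreasing_cvgn.
have mh : measurable_fun setT h.
  apply: (emeasurable_fun_cvg g) => // w' _; exact: gcvg.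
have h0 y : 0 <= h y.
  by apply: le_ereal_inf_tmp => _ [k _ <-].
have eh : e%:E <= \int[K n w]_y h y.
  have [||_ _ cvg1] := @dominated_convergence _ _ _ (K n w) setT measurableT g h
    (cst 1%:E) mg mh (aeW _ (fun w' _ => gcvg w')).
  - exact: (finite_measure_integrable_cst (kernel_at (K n) w) 1 measurableT).
  - by apply: aeW => w' k _ /=; rewrite gee0_abs// cyl_law_le1.
  apply: (cvge_to_ge cvg1).
  by apply: nearW => k; rewrite /g /= -cyl_law_step.
have [w' aw hw'] := @K_ex n w h e mh h0 eh.
exists w' => // k; apply: (le_trans hw').
by apply: ereal_inf_lbound; exists k.
Qed.

(** Continuity at the empty set: [cyl_law_nested] fixes the coordinates one by one
while keeping all the conditional probabilities above e, and the conditional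
probability of a cylinder whose coordinates are all fixed is 0 or 1. *)
Lemma cyl_law_meet w (S : nat -> set T) (r : nat -> nat) (e : R) : (0 < e)%R ->
  (forall k, cyl (r k) (S k)) -> nonincreasing_seq S ->
  (forall k, e%:E <= cyl_law 0 (r k) w (S k)) -> exists w', forall k, S k w'.
Proof.
move=> e0 cS ndS eS.
pose good n w := forall k, e%:E <= cyl_law n (r k) w (S k).
pose next n w := xget w [set w' | agree n w w' /\ good n.+1 w'].
have nextP m v : good m v -> agree m v (next m v) /\ good m.+1 (next m v).
  move=> gv; have [v' vv' gv'] := cyl_law_nested cS ndS gv.
  by apply: (@xgetI _ v [set w' | agree m v w' /\ good m.+1 w'] v').
pose f := fix f m := if m is m'.+1 then next m' (f m') else w.
have fP m : good m (f m) by elim: m => [//|m /nextP[]].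
have [w' fw'] : exists w', forall s, agree s (f s) w'.
  by apply: agree_lim => s; have [] := nextP _ _ (fP s).
exists w' => k; have := fP (r k) k.
rewrite /cyl_law subnn /= /kdirac /= diracE => ek.
case: (cS k) => _; apply; first exact: fw'.
by move: ek; case: (boolP (_ \in _)) => [/set_mem//|_]; rewrite lee_fin leNgt e0.
Qed.

(** The type T again, with the cylinders as its algebra of sets. *)
Definition cylinder_algebra : Type := T.
HB.instance Definition _ := Pointed.on cylinder_algebra.

Let algebra0 : [set S : set cylinder_algebra | exists s, cyl s S] set0.
Proof. by exists 0%N; exact: cyl0. Qed.

Let algebraU : setU_closed [set S : set cylinder_algebra | exists s, cyl s S].
Proof.
move=> S S' [s cS] [s' cS']; exists (maxn s s').
exact: (cylU (cyl_le (leq_maxl _ _) cS) (cyl_le (leq_maxr _ _) cS')).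
Qed.

Let algebraC : setC_closed [set S : set cylinder_algebra | exists s, cyl s S].
Proof. by move=> S [s cS]; exists s; exact: cylC. Qed.

HB.instance Definition _ := @isAlgebraOfSets.Build d cylinder_algebra
  [set S : set cylinder_algebra | exists s, cyl s S] algebra0 algebraU algebraC.

Definition cyl_rank (S : set T) : nat := xget 0%N [set s | cyl s S].

Definition premeasure (S : set cylinder_algebra) : \bar R :=
  cyl_law 0 (cyl_rank S) w0 S.

Lemma cyl_rankP s S : cyl s S -> cyl (cyl_rank S) S.
Proof. by move=> cS; exact: (@xgetI _ 0%N [set s | cyl s S] s). Qed.

Lemma premeasureE s S : cyl s S -> premeasure S = resample 0 s w0 S.
Proof.
move=> cS; rewrite /premeasure (@cyl_lawE _ _ (maxn s (cyl_rank S))).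
- by rewrite (@resample_stable_le s 0 s)// leq_maxl.
- exact: cyl_rankP cS.
- by rewrite add0n leq_maxr.
Qed.

Let premeasure0 : premeasure set0 = 0.
Proof. by rewrite (premeasureE (cyl0 0)) measure0. Qed.

Let premeasure_ge0 S : 0 <= premeasure S.
Proof. exact: measure_ge0. Qed.

Let premeasure_additive : measure_function.semi_additive premeasure.
Proof.
apply/additive2P => // A B [s cA] [s' cB] AB.
have cA' := cyl_le (leq_maxl s s') cA.
have cB' := cyl_le (leq_maxr s s') cB.
rewrite (premeasureE cA') (premeasureE cB') (premeasureE (cylU cA' cB')).
by rewrite measureU//; [case: cA|case: cB].
Qed.

HB.instance Definition _ := isContent.Build _ _ _ premeasure
  premeasure_ge0 premeasure_additive.

Let premeasure_sigma_subadditive : measurable_subset_sigma_subadditive premeasure.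
Proof.
move=> A F mF mA AF.
pose B n := A `\` \big[setU/set0]_(i < n) F i.
have mB n : measurable (B n) by apply: measurableD => //; exact: bigsetU_measurable.
have subB n : premeasure A <= \sum_(i < n) premeasure (F i) + premeasure (B n).
  pose F' k := if (k < n)%N then F k else B n.
  have -> : \sum_(i < n) premeasure (F i) + premeasure (B n) =
      \sum_(i < n.+1) premeasure (F' i).
    rewrite big_ord_recr /= /F' ltnn; congr (_ + _).
    by apply: eq_bigr => i _; rewrite ltn_ord.
  apply: content_subadditive => //.
    by move=> k _; rewrite /F'; case: ifP.
  rewrite big_ord_recr /= {2}/F' ltnn.
  under eq_bigr do rewrite /F' ltn_ord.
  by move=> x Ax; case: (pselect ((\big[setU/set0]_(i < n) F i) x)); [left|right].
(* If the sum fell short by e, what the first n sets leave of A would keep mass e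
   for every n, and these decreasing cylinders would have a common point. *)
rewrite leNgt; apply/negP => sumA.
have A1 : premeasure A <= 1.
  by case: mA => s cA; apply: cyl_law_le1; exact: cyl_rankP cA.
have Afin : premeasure A \is a fin_num.
  by rewrite ge0_fin_numE// (le_lt_trans A1)// ltry.
have sum0 : 0 <= \sum_(n <oo) premeasure (F n) by exact: nneseries_ge0.
have sumfin : \sum_(n <oo) premeasure (F n) \is a fin_num.
  by rewrite ge0_fin_numE// (lt_le_trans sumA)// leey.
pose e := (fine (premeasure A) - fine (\sum_(n <oo) premeasure (F n)))%R.
have e0 : (0 < e)%R by rewrite subr_gt0 fine_lt.
have [w' Bw'] : exists w', forall k, B k w'.
  apply: (@cyl_law_meet w0 B (fun k => cyl_rank (B k)) e) => //.
  - by move=> k; have [s] := mB k; exact: cyl_rankP.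
  - move=> m n mn; apply/subsetPset; apply: setDS.
    exact: subset_bigsetU.
  - move=> k; rewrite -[leRHS]/(premeasure (B k)).
    rewrite EFinB !fineK// leeBlDl//.
    apply: (le_trans (subB k)); apply: leeD => //.
    rewrite -(big_mkord xpredT (premeasure \o F)).
    by apply: nneseries_lim_ge.
have [n _ Fn] := AF _ (Bw' 0%N).1.
have [_] := Bw' n.+1.
by apply; rewrite big_ord_recr /=; right.
Qed.

HB.instance Definition _ := Content_SigmaSubAdditive_isMeasure.Build _ _ _
  premeasure premeasure_sigma_subadditive.

Hypothesis cyl_generate :
  (measurable : set (set T)) `<=` <<s [set S | exists s, cyl s S] >>.

Definition projective_limit (S : set T) : \bar R := measure_extension premeasure S.

Lemma projective_limitE s S : cyl s S -> projective_limit S = resample 0 s w0 S.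
Proof.
move=> cS; rewrite -(premeasureE cS).
by apply: measurable_mu_extE; exists s.
Qed.

Let projective_limit0 : projective_limit set0 = 0.
Proof. exact: measure0. Qed.

Let projective_limit_ge0 S : 0 <= projective_limit S.
Proof. exact: measure_ge0. Qed.

Let projective_limit_sigma_additive : semi_sigma_additive projective_limit.
Proof.
move=> F mF tF mUF.
by apply: (@measure_semi_sigma_additive _ _ _ (measure_extension premeasure)) => //;
  [move=> i|]; exact: cyl_generate.
Qed.

HB.instance Definition _ := isMeasure.Build _ _ _ projective_limit
  projective_limit0 projective_limit_ge0 projective_limit_sigma_additive.

Let projective_limitT : projective_limit setT = 1.
Proof. by rewrite (@projective_limitE 0%N)// resampleT. Qed.

HB.instance Definition _ := Measure_isProbability.Build _ _ _ projective_limit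
  projective_limitT.

(** The preimages under f are s-cylinders, so f has the same law under m1 and m2. *)
Lemma eq_integral_cyl (m1 m2 : {measure set T -> \bar R}) s (f : T -> \bar R) :
  (forall S, cyl s S -> m1 S = m2 S) ->
  (forall w, 0 <= f w) -> measurable_fun setT f ->
  (forall w w', agree s w w' -> f w = f w') ->
  \int[m1]_w f w = \int[m2]_w f w.
Proof.
move=> m12 f0 mf fagree.
have absE (m : {measure set T -> \bar R}) : \int[m]_w f w = \int[m]_w `|f w|.
  by apply: eq_integral => w _; rewrite gee0_abs.
rewrite !absE; apply: (eq_integral_law (g := abse) mf mf) => // B mB.
apply: m12; split; first by rewrite -(setTI (f @^-1` B)); exact: mf.
by move=> w w' /fagree; rewrite /preimage /= => ->.
Qed.

(** The extension coincides with [resample 0 s.+1] on cylinders of rank s.+1 and with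
[resample 0 s] on those of rank s, and [K s w S] depends only on the first s
coordinates of w. *)
Theorem ionescu_tulcea : exists P : probability T R,
  forall s S, cyl s.+1 S -> P S = \int[P]_w K s w S.
Proof.
exists projective_limit => s S cS.
have mS : measurable S by case: cS.
rewrite [LHS](projective_limitE cS) resample_recr// add0n.
apply: (@eq_integral_cyl _ _ s) => //.
- by move=> S' cS'; rewrite [RHS](projective_limitE cS').
- exact: measurable_kernel.
- by move=> w w'; exact: K_cylS.
Qed.

End ionescu_tulcea.

(** * The law of the trajectory *)

Section precomposition.
Context d0 d1 d2 (T0 : measurableType d0) (T1 : measurableType d1)
  (T2 : measurableType d2) (R : realType).
Variables (f : T0 -> T1) (mf : measurable_fun setT f) (k : R.-pker T1 ~> T2).

(** The measurability proof is an argument, as in [kdirac], so that the kernel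
structure can be inferred from the term. *)
Definition kernel_pre & measurable_fun setT f : T0 -> {measure set T2 -> \bar R} :=
  fun w => k (f w).

Let kernel_pre_measurable U : measurable U ->
  measurable_fun setT ((kernel_pre mf)^~ U).
Proof. by move=> mU; exact: measurableT_comp (measurable_kernel k U mU) mf. Qed.

HB.instance Definition _ := isKernel.Build _ _ _ _ _ (kernel_pre mf)
  kernel_pre_measurable.

Let kernel_pre_prob w : kernel_pre mf w setT = 1.
Proof. exact: prob_kernel. Qed.

HB.instance Definition _ := Kernel_isProbability.Build _ _ _ _ _
  (kernel_pre mf) kernel_pre_prob.

End precomposition.

Section update_kernel.
Context d0 d1 (T : measurableType d0) (Y : measurableType d1) (R : realType).
Variables (k : R.-pker T ~> Y) (upd : T * Y -> T).
Hypothesis mupd : measurable_fun setT upd.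

Definition update_law (w : T) : set T -> \bar R :=
  pushforward (k w) (fun y => upd (w, y)).

Let mupd1 w : measurable_fun setT (fun y => upd (w, y)).
Proof. by apply: measurableT_comp => //; exact: measurable_pair1. Qed.

Let update_law0 w : update_law w set0 = 0.
Proof. by rewrite /update_law /pushforward preimage_set0 measure0. Qed.

Let update_law_ge0 w S : 0 <= update_law w S.
Proof. exact: measure_ge0. Qed.

Let update_law_sigma_additive w : semi_sigma_additive (update_law w).
Proof.
move=> F mF tF mUF.
exact: (@measure_semi_sigma_additive _ _ _
  (pushforward (k w) (fun y => upd (w, y)) : {measure set T -> \bar R})).
Qed.

HB.instance Definition _ w := isMeasure.Build _ _ _ (update_law w)
  (update_law0 w) (update_law_ge0 w) (@update_law_sigma_additive w).

Definition update_kernel : T -> {measure set T -> \bar R} :=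
  update_law.

Let update_kernel_measurable U : measurable U ->
  measurable_fun setT (update_kernel^~ U).
Proof.
move=> mU.
have -> : update_kernel^~ U = (fun w => k w (xsection (upd @^-1` U) w)).
  apply/funext => w; rewrite /update_kernel /update_law /pushforward.
  by congr (k w _); apply/seteqP; split => y; rewrite /xsection /= inE.
apply: measurable_fun_xsection_finite_kernel; rewrite inE.
by rewrite -(setTI (upd @^-1` U)); exact: mupd.
Qed.

HB.instance Definition _ := isKernel.Build _ _ _ _ _ update_kernel
  update_kernel_measurable.

Let update_kernel_prob w : update_kernel w setT = 1.
Proof. by rewrite /update_kernel /= /update_law /pushforward preimage_setT prob_kernel. Qed.

HB.instance Definition _ := Kernel_isProbability.Build _ _ _ _ _
  update_kernel update_kernel_prob.

Lemma update_kernelE w S : update_kernel w S = k w [set y | S (upd (w, y))].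
Proof. by []. Qed.

Lemma ge_integral_update_ex w (h : T -> \bar R) (e : R) :
  measurable_fun setT h -> (forall y, 0 <= h y) ->
  e%:E <= \int[update_kernel w]_y h y -> exists y, e%:E <= h (upd (w, y)).
Proof.
move=> mh h0 eh.
apply: (@ge_integral_ex _ _ _ (kernel_at k w) (fun y => h (upd (w, y)))) => //.
  by apply: measurableT_comp.
apply: le_trans eh _.
rewrite [leLHS](_ : _ = \int[pushforward (k w) (fun y => upd (w, y))]_y h y)//.
by rewrite ge0_integral_pushforward.
Qed.

Variables (agree : nat -> T -> T -> Prop).
Hypothesis agree_sym : forall s w w', agree s w w' -> agree s w' w.
Hypothesis agree_le : forall s s' w w', (s <= s')%N -> agree s' w w' -> agree s w w'.

Lemma update_kernel_cyl r (upd_agree : forall w y, agree r w (upd (w, y))) s S w :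
  (s <= r)%N -> agreement_cylinder agree s S -> update_kernel w S = \d_w S.
Proof.
move=> sr [mS iS]; rewrite update_kernelE.
have wy y := agree_le sr (upd_agree w y).
rewrite diracE; case: (boolP (w \in S)) => [/set_mem Sw|/negP wS].
  rewrite (_ : [set y | _] = setT) ?prob_kernel//.
  by apply/seteqP; split => // y _ /=; exact: iS Sw.
rewrite (_ : [set y | _] = set0) ?measure0//.
by rewrite -subset0 => y /= Sy; apply: wS; apply/mem_set; exact: iS (agree_sym (wy y)) Sy.
Qed.

Lemma update_kernel_cylS s S w w' :
  (forall w w' y, agree s w w' -> agree s.+1 (upd (w, y)) (upd (w', y))) ->
  (agree s w w' -> k w = k w') -> agreement_cylinder agree s.+1 S ->
  agree s w w' -> update_kernel w S = update_kernel w' S.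
Proof.
move=> hu hk [mS iS] ww'; rewrite !update_kernelE hk//.
congr (k w' _); apply/seteqP; split => y /=; apply: iS; first exact: hu.
exact/hu/agree_sym.
Qed.

End update_kernel.
Arguments update_kernel {d0 d1 T Y R} k {upd} _.

Section trajectories.
Context (R : realType) (dX dA : measure_display).
Context (X : measurableMetricType R dX) (A : measurableMetricType R dA).
Local Notation Omega := (trajectory X A).

Lemma measurable_coordinate t :
  measurable_fun setT (fun om : Omega => om t).
Proof.
move=> _ B mB; rewrite setTI; apply: sub_sigma_algebra; exists t => //.
by exists B => //; rewrite setTI.
Qed.

Lemma measurable_fun_trajectory d (T : measurableType d) (f : T -> Omega) :
  (forall t, measurable_fun setT (fun w => f w t)) -> measurable_fun setT f.
Proof.
move=> mf; apply: (@measurability _ _ _ _ _ f (coordinate_events (X := X) (A := A))) => //.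
move=> _ [_ [t _ [B mB <-]] <-].
rewrite setTI -comp_preimage.
by have := mf t measurableT B mB; rewrite setTI.
Qed.

Lemma measurable_past t : measurable_fun setT (@past _ _ _ X A t).
Proof.
apply/measurable_fun_tnthP => i.
rewrite (_ : _ \o _ = (fun om : Omega => om i)).
  exact: measurable_coordinate.
by apply/funext => om /=; rewrite tnth_mktuple.
Qed.

Lemma measurable_history_of t : measurable_fun setT (@history_of _ _ _ X A t).
Proof.
apply/measurable_fun_pair; first exact: measurable_past.
exact: measurableT_comp measurable_fst (measurable_coordinate t).
Qed.

Definition set_state (t : nat) (z : Omega * X) : Omega :=
  fun i => if i == t then (z.2, (z.1 i).2) else z.1 i.

Definition set_action (t : nat) (z : Omega * A) : Omega :=
  fun i => if i == t then ((z.1 i).1, z.2) else z.1 i.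

Lemma measurable_set_state t : measurable_fun setT (set_state t).
Proof.
apply: measurable_fun_trajectory => i; rewrite /set_state.
have mi : measurable_fun setT (fun z : Omega * X => z.1 i).
  exact: measurableT_comp (measurable_coordinate i) measurable_fst.
case: eqP => // _; apply/measurable_fun_pair => //=.
exact: measurableT_comp measurable_snd mi.
Qed.

Lemma measurable_set_action t : measurable_fun setT (set_action t).
Proof.
apply: measurable_fun_trajectory => i; rewrite /set_action.
have mi : measurable_fun setT (fun z : Omega * A => z.1 i).
  exact: measurableT_comp (measurable_coordinate i) measurable_fst.
case: eqP => // _; apply/measurable_fun_pair => //=.
exact: measurableT_comp measurable_fst mi.
Qed.

(** The coordinates are ordered as x_0, a_0, x_1, a_1, ...: the state at time i has
rank 2 i and the action has rank 2 i + 1. *)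
Definition agree (s : nat) (w w' : Omega) : Prop := forall i,
  ((i.*2 < s)%N -> (w i).1 = (w' i).1) /\
  ((i.*2.+1 < s)%N -> (w i).2 = (w' i).2).

Lemma agree_sym s w w' : agree s w w' -> agree s w' w.
Proof. by move=> h i; have [h1 h2] := h i; split => ?; rewrite ?h1// h2. Qed.

Lemma agree_le s s' w w' : (s <= s')%N -> agree s' w w' -> agree s w w'.
Proof.
by move=> ss' h i; have [h1 h2] := h i; split => si;
  [apply: h1|apply: h2]; exact: leq_trans ss'.
Qed.

Lemma agree_trans s w w' w'' : agree s w w' -> agree s w' w'' -> agree s w w''.
Proof.
by move=> h h' i; have [h1 h2] := h i; have [h1' h2'] := h' i; split => si;
  rewrite ?h1// ?h1'// ?h2// h2'.
Qed.

Lemma agree_lim (f : nat -> Omega) :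
  (forall s, agree s (f s) (f s.+1)) -> exists w, forall s, agree s (f s) w.
Proof.
move=> fS.
have fle m n : (m <= n)%N -> agree m (f m) (f n).
  elim: n => [|n IH]; first by rewrite leqn0 => /eqP ->.
  rewrite leq_eqVlt => /predU1P[<-//|]; rewrite ltnS => mn.
  exact: agree_trans (IH mn) (agree_le mn (fS n)).
(* x_i is settled from stage 2 i + 1 on and a_i from stage 2 i + 2 on *)
exists (fun i => ((f i.*2.+1 i).1, (f i.*2.+2 i).2)) => s i; split => si /=.
  by have [/(_ (leqnn _)) -> _] := fle _ _ si i.
by have [_ /(_ (leqnn _)) ->] := fle _ _ si i.
Qed.

Lemma cylinder_generate : (measurable : set (set Omega)) `<=`
  <<s [set S | exists s, agreement_cylinder agree s S] >>.
Proof.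
apply: sub_sigma_algebra2 => _ [t _ [B mB <-]].
exists t.*2.+2; split; first by apply: measurable_coordinate.
move=> w w' ww'; rewrite setTI /=.
have -> // : w t = w' t.
have [h1 h2] := ww' t.
by rewrite (surjective_pairing (w t)) h1 ?h2 -?surjective_pairing// ltnW.
Qed.

Arguments measurable_coordinate t : clear implicits.
Arguments measurable_past t : clear implicits.
Arguments measurable_history_of t : clear implicits.
Arguments measurable_set_state t : clear implicits.
Arguments measurable_set_action t : clear implicits.

Section induced_probability.
Variables (q : R.-pker (X * A)%type ~> X) (pi : policy X A) (x : X).

Definition next_state (t : nat) : R.-pker Omega ~> X :=
  if t is t'.+1 then kernel_pre q (measurable_coordinate t')
  else kdirac (@measurable_cst _ _ _ _ setT x).

Definition trajectory_step (s : nat) : R.-pker Omega ~> Omega :=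
  if odd s then
    (update_kernel (kernel_pre (pi s./2) (measurable_history_of s./2))
      (measurable_set_action s./2) : R.-pker Omega ~> Omega)
  else update_kernel (next_state s./2) (measurable_set_state s./2).

Lemma agree_set_state t w y : agree t.*2 w (set_state t (w, y)).
Proof.
move=> i; rewrite /set_state; case: eqP => [->|//]; split => //=.
by rewrite ltnn.
Qed.

Lemma agree_set_action t w a : agree t.*2.+1 w (set_action t (w, a)).
Proof.
move=> i; rewrite /set_action; case: eqP => [->|//]; split => //=.
by rewrite ltnn.
Qed.

Lemma agreeS_set_state t w w' y : agree t.*2 w w' ->
  agree t.*2.+1 (set_state t (w, y)) (set_state t (w', y)).
Proof.
move=> ww' i; have [h1 h2] := ww' i; rewrite /set_state; case: eqP => [->|/eqP it].
  by split => //=; rewrite ltnn.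
split=> si; first by rewrite h1//; move: it si; lia.
by rewrite h2//; move: it si; lia.
Qed.

Lemma agreeS_set_action t w w' a : agree t.*2.+1 w w' ->
  agree t.*2.+2 (set_action t (w, a)) (set_action t (w', a)).
Proof.
move=> ww' i; have [h1 h2] := ww' i; rewrite /set_action; case: eqP => [->|/eqP it].
  by split => //= _; have [->] := ww' t.
split=> si; first by rewrite h1//; move: it si; lia.
by rewrite h2//; move: it si; lia.
Qed.

Lemma agree_past t s w w' : (t.*2 <= s)%N -> agree s w w' -> past t w = past t w'.
Proof.
move=> ts ww'; apply/eq_from_tnth => i; rewrite !tnth_mktuple.
have [h1 h2] := ww' i; rewrite (surjective_pairing (w i)) h1 ?h2 -?surjective_pairing//.
  by apply: leq_trans ts; rewrite -doubleS leq_double.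
by apply: leq_trans ts; have := ltn_ord i; lia.
Qed.

Lemma agree_history_of t s w w' : (t.*2 < s)%N -> agree s w w' ->
  history_of t w = history_of t w'.
Proof.
move=> ts ww'; rewrite /history_of (agree_past (ltnW ts) ww').
by have [-> //] := ww' t.
Qed.

Lemma next_state_agree t w w' : agree t.*2 w w' -> next_state t w = next_state t w'.
Proof.
case: t => // t ww'; rewrite /next_state /= /kernel_pre.
suff -> : w t = w' t by [].
have [h1 h2] := ww' t.
by rewrite (surjective_pairing (w t)) h1 ?h2 -?surjective_pairing// doubleS.
Qed.

Lemma trajectory_step_double t : trajectory_step t.*2 =
  (update_kernel (next_state t) (measurable_set_state t) : R.-pker Omega ~> Omega).
Proof. by rewrite /trajectory_step odd_double doubleK. Qed.

Lemma trajectory_step_doubleS t : trajectory_step t.*2.+1 =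
  (update_kernel (kernel_pre (pi t) (measurable_history_of t))
    (measurable_set_action t) : R.-pker Omega ~> Omega).
Proof. by rewrite /trajectory_step /= odd_double /= uphalf_double. Qed.

Lemma trajectory_step_state t w S : trajectory_step t.*2 w S =
  next_state t w [set y | S (set_state t (w, y))].
Proof. by rewrite trajectory_step_double. Qed.

Lemma trajectory_step_action t w S : trajectory_step t.*2.+1 w S =
  pi t (history_of t w) [set a | S (set_action t (w, a))].
Proof. by rewrite trajectory_step_doubleS. Qed.

Lemma parity_ind (P : nat -> Prop) :
  (forall t, P t.*2) -> (forall t, P t.*2.+1) -> forall s, P s.
Proof.
move=> P0 P1 s; rewrite -(odd_double_half s).
by case: (odd s); rewrite ?add1n ?add0n.
Qed.

Lemma trajectory_step_cyl s r S w : (s <= r)%N ->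
  agreement_cylinder agree s S -> trajectory_step r w S = \d_w S.
Proof.
elim/parity_ind: r => t st cS.
  rewrite trajectory_step_double.
  exact: (update_kernel_cyl (next_state t) (measurable_set_state t)
    (@agree_sym) (@agree_le) (@agree_set_state t) w st cS).
rewrite trajectory_step_doubleS.
exact: (update_kernel_cyl (kernel_pre (pi t) (measurable_history_of t))
  (measurable_set_action t) (@agree_sym) (@agree_le) (@agree_set_action t) w st cS).
Qed.

Lemma trajectory_step_cylS s S w w' : agreement_cylinder agree s.+1 S ->
  agree s w w' -> trajectory_step s w S = trajectory_step s w' S.
Proof.
elim/parity_ind: s => t cS ww'.
  rewrite trajectory_step_double.
  apply: (@update_kernel_cylS _ _ _ _ _ (next_state t) _ (measurable_set_state t)
    agree (@agree_sym) _ _ _ _ _ _ cS ww').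
  - exact: agreeS_set_state.
  - exact: next_state_agree.
rewrite trajectory_step_doubleS.
apply: (@update_kernel_cylS _ _ _ _ _ (kernel_pre (pi t) (measurable_history_of t))
  _ (measurable_set_action t) agree (@agree_sym) _ _ _ _ _ _ cS ww').
- exact: agreeS_set_action.
- by move=> h; exact: (congr1 (pi t) (agree_history_of (leqnn _) h)).
Qed.

Lemma trajectory_step_ex s w (h : Omega -> \bar R) (e : R) :
  measurable_fun setT h -> (forall y, 0 <= h y) ->
  e%:E <= \int[trajectory_step s w]_y h y ->
  exists2 w', agree s w w' & e%:E <= h w'.
Proof.
move=> mh h0; elim/parity_ind: s => t.
  rewrite trajectory_step_double => /(ge_integral_update_ex mh h0)[y hy].
  by exists (set_state t (w, y)) => //; exact: agree_set_state.
rewrite trajectory_step_doubleS => /(ge_integral_update_ex mh h0)[y hy].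
by exists (set_action t (w, y)) => //; exact: agree_set_action.
Qed.

Lemma history_of_set_action t w a : history_of t (set_action t (w, a)) = history_of t w.
Proof. exact/esym/(agree_history_of (leqnn _))/agree_set_action. Qed.

Lemma past_set_state t w y : past t (set_state t (w, y)) = past t w.
Proof. exact/esym/(agree_past (leqnn _))/agree_set_state. Qed.

(** The three clauses of [induced_by] are the equation of [ionescu_tulcea] for s equal
to 0, 2 t + 1 and 2 t + 2. *)
Lemma induced_probability_exists : exists P, induced_by q pi x P.
Proof.
have [P PK] : exists P : probability Omega R,
    forall s S, agreement_cylinder agree s.+1 S ->
      P S = \int[P]_w trajectory_step s w S.
  apply: (ionescu_tulcea (point : Omega) (@agree_sym) (@agree_le) (@agree_lim)).
  - exact: trajectory_step_cyl.
  - exact: trajectory_step_cylS.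
  - exact: trajectory_step_ex.
  - exact: cylinder_generate.
have mpre d (T : measurableType d) (f : Omega -> T) (B : set T) :
    measurable_fun setT f -> measurable B -> measurable (f @^-1` B).
  by move=> mf mB; rewrite -(setTI (f @^-1` B)); exact: mf.
have mstate t : measurable_fun setT (fun om : Omega => (om t).1).
  exact: measurableT_comp measurable_fst (measurable_coordinate t).
have maction t : measurable_fun setT (fun om : Omega => (om t).2).
  exact: measurableT_comp measurable_snd (measurable_coordinate t).
exists P; split.
- move=> B mB; rewrite (PK 0%N); last first.
    split; first exact: mpre (mstate 0%N) mB.
    by move=> w w' /(_ 0%N)[/(_ isT) h _] /=; rewrite h.
  under eq_integral => w _ do
    rewrite (trajectory_step_state 0) /set_state /=.
  by rewrite integral_prob_cst.
- move=> t B C mB mC.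
  have mhB := mpre _ _ _ _ (measurable_history_of t) mB.
  rewrite (PK t.*2.+1); last first.
    split; first exact: measurableI mhB (mpre _ _ _ _ (maction t) mC).
    move=> w w' ww' [] /=; rewrite (agree_history_of _ ww')//.
    by have [_ -> //] := ww' t.
  rewrite [RHS]integral_mkcond; apply: eq_integral => w _.
  rewrite trajectory_step_action patchE.
  under eq_set do rewrite /= history_of_set_action /set_action eqxx /=.
  case: ifPn => [/set_mem hw|/negP hw].
    by congr (pi t _ _); apply/seteqP; split => [y []|y Cy].
  rewrite (_ : [set y | _] = set0) ?measure0//.
  by rewrite -subset0 => y [/mem_set].
- move=> t B C mB mC.
  have mhB := mpre _ _ _ _ (measurable_past t.+1) mB.
  rewrite (PK t.+1.*2); last first.
    split; first exact: measurableI mhB (mpre _ _ _ _ (mstate t.+1) mC).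
    move=> w w' ww' [] /=; rewrite (agree_past _ ww')//.
    by have [-> //] := ww' t.+1.
  rewrite [RHS]integral_mkcond; apply: eq_integral => w _.
  rewrite trajectory_step_state patchE.
  under eq_set do rewrite /= past_set_state /set_state eqxx /=.
  case: ifPn => [/set_mem hw|/negP hw].
    by congr (q _ _); apply/seteqP; split => [y []|y Cy].
  rewrite (_ : [set y | _] = set0) ?measure0//.
  by rewrite -subset0 => y [/mem_set].
Qed.

Lemma traj_prob_induced : induced_by q pi x (traj_prob q pi x).
Proof. by rewrite /traj_prob; apply: getPex; exact: induced_probability_exists. Qed.

End induced_probability.

End trajectories.

(** * One-dimensional marginals of the trajectory law *)

(** All the estimates of costs below use the trajectory law only through
[integral_initial_state], [integral_next_state] and [integral_det_action]. *)
Section marginals.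
Context (R : realType) (dX dA : measure_display).
Context (X : measurableMetricType R dX) (A : measurableMetricType R dA).
Variables (q : R.-pker (X * A)%type ~> X) (pi : policy X A) (x : X).
Local Notation Omega := (trajectory X A).
Local Notation P := (traj_prob q pi x).

Lemma measurable_state t : measurable_fun setT (fun om : Omega => (om t).1).
Proof. exact: measurableT_comp measurable_fst (measurable_coordinate t). Qed.

Lemma measurable_action t : measurable_fun setT (fun om : Omega => (om t).2).
Proof. exact: measurableT_comp measurable_snd (measurable_coordinate t). Qed.

Lemma integral_initial_state (f : X -> \bar R) :
  measurable_fun setT f -> (forall y, 0 <= f y) ->
  \int[P]_om f (om 0%N).1 = f x.
Proof.
move=> mf f0; have [P0 _ _] := traj_prob_induced q pi x.
rewrite (@eq_integral_law _ _ _ _ _ _ _ P (\d_x) _ id f (measurable_state 0))//.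
by rewrite integral_dirac// diracT mul1e.
Qed.

Lemma integral_next_state t (f : X -> \bar R) :
  measurable_fun setT f -> (forall y, 0 <= f y) ->
  \int[P]_om f (om t.+1).1 = \int[P]_om \int[q (om t)]_y f y.
Proof.
move=> mf f0; have [_ _ Pq] := traj_prob_induced q pi x.
pose k1 := kprobability (@measurable_cst _ _ unit _ setT (P : pprobability _ R)).
pose k := mkcomp_noparam k1 (kernel_pre q (measurable_coordinate t)).
rewrite (@eq_integral_law _ _ _ _ _ _ _ P (k tt) _ id f (measurable_state t.+1))//.
  by rewrite ge0_integral_kcomp_noparam.
move=> C mC.
have := Pq t setT C measurableT mC.
by rewrite preimage_setT setTI.
Qed.

End marginals.

Arguments measurable_state {R dX dA X A} t _ _ _.
Arguments measurable_action {R dX dA X A} t _ _ _.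

Section deterministic_marginal.
Context (R : realType) (dX dA : measure_display).
Context (X : measurableMetricType R dX) (A : measurableMetricType R dA).
Variables (q : R.-pker (X * A)%type ~> X) (phi : {mfun X >-> A}) (x : X).
Local Notation Omega := (trajectory X A).
Local Notation P := (traj_prob q (det_policy phi) x).

(** The laws of (x_t, a_t) and of (x_t, phi x_t) agree on measurable rectangles. *)
Lemma integral_det_action t (g : X * A -> \bar R) :
  measurable_fun setT g -> (forall y, 0 <= g y) ->
  \int[P]_om g (om t) = \int[P]_om g ((om t).1, phi (om t).1).
Proof.
move=> mg g0; have [_ Ppi _] := traj_prob_induced q (det_policy phi) x.
have mphi : measurable_fun setT (fun om : Omega => ((om t).1, phi (om t).1)).
  apply/measurable_fun_pair; first exact: (measurable_state t).
  exact: measurableT_comp (measurable_funPT phi) (measurable_state t).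
apply: (@eq_integral_law _ _ _ _ _ _ _ P P _ _ g (measurable_coordinate t) mphi) => //.
pose m1 : {measure set _ -> \bar R} := pushforward P (fun om : Omega => om t).
pose m2 : {measure set _ -> \bar R} :=
  pushforward P (fun om : Omega => ((om t).1, phi (om t).1)).
suff m12 B : measurable B -> m1 (measurable_coordinate t) B = m2 mphi B by exact: m12.
move: B.
apply: (measure_unique [set D `*` C | D in measurable & C in measurable]
  (fun=> setT)).
- exact: measurable_prod_measurableType.
- move=> _ _ [D1 mD1 [C1 mC1 <-]] [D2 mD2 [C2 mC2 <-]].
  exists (D1 `&` D2); first exact: measurableI.
  by exists (C1 `&` C2); [exact: measurableI|rewrite setXI].
- by move=> _; exists setT => //; exists setT => //; rewrite setXTT.
- by rewrite bigcup_const.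
- move=> _ [D mD [C mC <-]].
  transitivity (P ((fun om : Omega => om t) @^-1` (D `*` C))); first by [].
  transitivity (P [set om : Omega | (D `*` C) ((om t).1, phi (om t).1)]); last by [].
  have := Ppi t (snd @^-1` D) C _ mC.
  have mD' : measurable (snd @^-1` D : set (history X A t)).
    by rewrite -(setTI (_ @^-1` _)); exact: measurable_snd.
  move=> /(_ mD').
  rewrite (_ : _ `&` _ = (fun om : Omega => om t) @^-1` (D `*` C))// => ->.
  under eq_integral do rewrite /det_policy /kdirac /= diracE.
  have -> : [set om : Omega | (D `*` C) ((om t).1, phi (om t).1)] =
      (fun om : Omega => (om t).1) @^-1` D `&`
      ((fun om : Omega => phi (om t).1) @^-1` C) by [].
  have mC' : measurable ((fun om : Omega => phi (om t).1) @^-1` C).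
    rewrite -(setTI (_ @^-1` _)).
    exact: (measurableT_comp (measurable_funPT phi) (measurable_state t)).
  have mDom : measurable ((fun om : Omega => (om t).1) @^-1` D).
    by rewrite -(setTI (_ @^-1` _)); exact: measurable_state.
  transitivity (\int[P]_(om in (fun om : Omega => (om t).1) @^-1` D)
    (\1_((fun om : Omega => phi (om t).1) @^-1` C) om)%:E); first by [].
  by rewrite integral_indic// setIC.
- move=> _; apply: (@le_lt_trans _ _ (P setT)); first by [].
  by rewrite probability_setT ltry.
Qed.

End deterministic_marginal.

(** * Joint lower limits and Lipschitz envelopes *)

Section lipschitz_envelope.
Context (R : realType) (X : metricType R).
Variable f : nat -> X -> \bar R.
Hypothesis f0 : forall n y, 0 <= f n y.

Definition truncated (m : nat) (a : \bar R) : R := fine (mine (m%:R)%:E a).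

(** The Pasch-Hausdorff envelope with constant m of the functions f n, n >= m,
truncated at m so that it is real and bounded. *)
Definition envelope (m : nat) (x : X) : R :=
  inf [set truncated m (f nz.1 nz.2) + m%:R * mdist x nz.2 |
    nz in [set nz : nat * X | (m <= nz.1)%N]]%R.

Lemma truncatedE m a : 0 <= a -> (truncated m a)%:E = mine (m%:R)%:E a.
Proof.
move=> a0; rewrite /truncated fineK// ge0_fin_numE.
  by rewrite (@le_lt_trans _ _ m%:R%:E) ?ltry// ge_min lexx.
by rewrite le_min a0 lee_fin ler0n.
Qed.

Lemma truncated_ge0 m a : 0 <= a -> (0 <= truncated m a)%R.
Proof. by move=> a0; rewrite -lee_fin truncatedE// le_min a0 lee_fin ler0n. Qed.

Lemma truncated_le m a : 0 <= a -> (truncated m a)%:E <= a.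
Proof. by move=> a0; rewrite truncatedE// ge_min lexx orbT. Qed.

Lemma truncated_len m a : 0 <= a -> (truncated m a <= m%:R)%R.
Proof. by move=> a0; rewrite -lee_fin truncatedE// ge_min lexx. Qed.

Lemma truncated_homo m m' a : (m <= m')%N -> 0 <= a ->
  (truncated m a <= truncated m' a)%R.
Proof.
move=> mm' a0; rewrite -lee_fin !truncatedE// le_min !ge_min lexx orbT.
by rewrite lee_fin ler_nat mm'.
Qed.

Lemma envelope_le m n x y : (m <= n)%N ->
  (envelope m x <= truncated m (f n y) + m%:R * mdist x y)%R.
Proof.
move=> mn; apply: ge_inf; last by exists (n, y).
exists 0%R => _ [[n' y'] _ <-] /=.
by rewrite addr_ge0 ?truncated_ge0// mulr_ge0// mdist_ge0.
Qed.

Lemma le_envelope m x (a : R) :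
  (forall n y, (m <= n)%N -> (a <= truncated m (f n y) + m%:R * mdist x y)%R) ->
  (a <= envelope m x)%R.
Proof.
move=> h; apply: lb_le_inf.
  by exists (truncated m (f m x) + m%:R * mdist x x)%R; exists (m, x) => /=.
by move=> _ [[n y] mn <-] /=; exact: h.
Qed.

Lemma envelope_ge0 m x : (0 <= envelope m x)%R.
Proof.
by apply: le_envelope => n y _; rewrite addr_ge0 ?truncated_ge0// mulr_ge0// mdist_ge0.
Qed.

Lemma envelope_len m x : (envelope m x <= m%:R)%R.
Proof.
apply: le_trans (@envelope_le m m x x (leqnn m)) _.
by rewrite mdistxx mulr0 addr0 truncated_len.
Qed.

Lemma envelope_lef m n x : (m <= n)%N -> (envelope m x)%:E <= f n x.
Proof.
move=> mn; apply: le_trans (truncated_le m (f0 n x)).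
rewrite lee_fin; apply: le_trans (@envelope_le m n x x mn) _.
by rewrite mdistxx mulr0 addr0.
Qed.

Lemma envelope_homo m m' x : (m <= m')%N -> (envelope m x <= envelope m' x)%R.
Proof.
move=> mm'; apply: le_envelope => n y m'n.
apply: le_trans (@envelope_le m n x y (leq_trans mm' m'n)) _.
apply: lerD; first exact: truncated_homo.
by rewrite ler_wpM2r ?mdist_ge0// ler_nat.
Qed.

Lemma envelope_lipschitz m x y : (envelope m x <= envelope m y + m%:R * mdist x y)%R.
Proof.
rewrite -lerBlDr; apply: le_envelope => n z mn.
rewrite lerBlDr -addrA.
apply: le_trans (@envelope_le m n x z mn) _.
rewrite lerD2l -mulrDr ler_wpM2l// addrC; exact: metric_triangle.
Qed.

Lemma envelope_continuous m : continuous (envelope m).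
Proof.
move=> x; apply/cvgrPdist_lt => e e0.
have d0 : (0 < e / m.+1%:R)%R by rewrite divr_gt0.
have : nbhs x (ball x (e / m.+1%:R)) by exact: nbhsx_ballx.
apply: filterS => y; rewrite ballEmdist /= => xy.
have le1 : (m%:R * mdist x y < e)%R.
  apply: (@le_lt_trans _ _ (m.+1%:R * mdist x y)%R).
    by rewrite ler_wpM2r ?mdist_ge0// ler_nat.
  by rewrite mulrC -ltr_pdivlMr.
rewrite ltr_norml; apply/andP; split.
  have := envelope_lipschitz m y x; rewrite metric_sym; lra.
have := envelope_lipschitz m x y; lra.
Qed.

Lemma liminf_nbhs_gtP (x : X) (a : \bar R) : a < liminf_nbhs f x ->
  exists mr : nat * R, (0 < mr.2)%R /\ exists2 b, a < b &
    forall n y, (mr.1 <= n)%N -> ball x mr.2 y -> b <= f n y.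
Proof.
move=> /ereal_sup_gtP[_ [mr mr0 <-] ab]; exists mr; split => //.
eexists; first exact: ab.
by move=> n y mn xy; apply: ereal_inf_lbound; exists (n, y).
Qed.

Lemma le_liminf_nbhs (x : X) (a : \bar R) m (r : R) : (0 < r)%R ->
  (forall n y, (m <= n)%N -> ball x r y -> a <= f n y) -> a <= liminf_nbhs f x.
Proof.
move=> r0 h; apply: (@le_trans _ _
   (ereal_inf [set f nz.1 nz.2 | nz in [set nz | (m <= nz.1)%N /\ ball x r nz.2]])).
  by apply: le_ereal_inf_tmp => _ [[n y] [/= mn xy] <-]; exact: h.
by apply: ereal_sup_ubound; exists (m, r).
Qed.

Lemma liminf_nbhs_ge0 x : 0 <= liminf_nbhs f x.
Proof. by apply: (@le_liminf_nbhs x 0 0%N 1%R). Qed.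

(** A point at distance less than e / (m + 1) from x contributes a penalty of at most
e, so the envelopes stay below the lower limit. Conversely, when f n >= b on the
ball of radius r for n >= m0, a large m makes the penalty m r outside the ball
exceed any real t <= b. *)
Lemma liminf_nbhs_envelope x :
  liminf_nbhs f x = ereal_sup (range (fun m => (envelope m x)%:E)).
Proof.
apply/eqP; rewrite eq_le; apply/andP; split; last first.
  apply: ge_ereal_sup => _ [m _ <-].
  apply/lee_addgt0Pr => e e0; rewrite -leeBlDr//.
  apply: (@le_liminf_nbhs x _ m (e / m.+1%:R)); first by rewrite divr_gt0.
  move=> n y mn; rewrite ballEmdist /= => xy.
  apply: le_trans _ (truncated_le m (f0 n y)).
  rewrite -EFinB lee_fin lerBlDr; apply: le_trans (envelope_le x y mn) _.
  rewrite lerD2l; apply: (@le_trans _ _ (m.+1%:R * mdist x y)%R).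
    by rewrite ler_wpM2r ?mdist_ge0// ler_nat.
  by rewrite mulrC -ler_pdivlMr// ltW.
rewrite leNgt; apply/negP => /liminf_nbhs_gtP[[m0 r] [/= r0 [b ab bf]]].
have S0 : 0 <= ereal_sup (range (fun m => (envelope m x)%:E)).
  by apply: ereal_sup_ge; exists (envelope 0 x)%:E; [exists 0%N|rewrite lee_fin envelope_ge0].
have Sfin : ereal_sup (range (fun m => (envelope m x)%:E)) \is a fin_num.
  by rewrite ge0_fin_numE// (lt_le_trans ab)// leey.
set S := fine (ereal_sup (range (fun m => (envelope m x)%:E))).
have SE : ereal_sup (range (fun m => (envelope m x)%:E)) = S%:E by rewrite fineK.
have Sr0 : (0 <= S)%R by rewrite -lee_fin -SE.
rewrite SE in ab.
have [t St tb] : exists2 t : R, (S < t)%R & t%:E <= b.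
  case: b ab {bf} => [b|_|//]; last by exists (S + 1)%R; rewrite ?ltrDl ?leey.
  by rewrite lte_fin => Sb; exists b.
have t0 : (0 <= t)%R by apply: (le_trans Sr0); exact: ltW.
pose m := maxn m0 (maxn (Num.truncn t).+1 (Num.truncn (t / r)).+1).
have tm : (t <= m%:R)%R.
  apply: (@le_trans _ _ (Num.truncn t).+1%:R); first exact/ltW/truncnS_gt.
  by rewrite ler_nat /m; lia.
have trm : (t / r <= m%:R)%R.
  apply: (@le_trans _ _ (Num.truncn (t / r)).+1%:R); first exact/ltW/truncnS_gt.
  by rewrite ler_nat /m; lia.
have : (t <= envelope m x)%R.
  apply: le_envelope => n y mn.
  have [xy|xy] := ltP (mdist x y) r.
    have h : (t <= truncated m (f n y))%R.
      rewrite -lee_fin truncatedE// le_min lee_fin tm.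
      apply: (le_trans tb); apply: bf; last by rewrite ballEmdist.
      by apply: leq_trans mn; rewrite leq_maxl.
    by apply: (le_trans h); rewrite lerDl mulr_ge0// mdist_ge0.
  rewrite ler_pdivrMr// in trm; apply: (le_trans trm).
  apply: (@le_trans _ _ (m%:R * mdist x y)%R); first by rewrite ler_wpM2l.
  by rewrite lerDr truncated_ge0.
apply/negP; rewrite -ltNge; apply: le_lt_trans St.
by rewrite -lee_fin -SE; apply: ereal_sup_ubound; exists m.
Qed.

Lemma envelope_cvg x : (envelope m x)%:E @[m --> \oo] --> liminf_nbhs f x.
Proof.
rewrite liminf_nbhs_envelope; apply: ereal_nondecreasing_cvgn => m m' mm'.
by rewrite lee_fin envelope_homo.
Qed.

End lipschitz_envelope.

Lemma lte_dense (R : realType) (a b : \bar R) : a < b -> exists r : R, a < r%:E < b.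
Proof.
case: a => [a| |]; case: b => [b| |] //=.
- by rewrite lte_fin => ab; exists ((a + b) / 2)%R; rewrite !lte_fin; apply/andP; split; lra.
- by move=> _; exists (a + 1)%R; rewrite lte_fin ltrDl ltr01 ltry.
- by move=> _; exists (b - 1)%R; rewrite ltNyr lte_fin gtrBl ltr01.
- by move=> _; exists 0%R; rewrite ltNyr ltry.
Qed.

Lemma near_invnS (R : realType) (e : R) : (0 < e)%R ->
  \forall n \near \oo, (n.+1%:R^-1 <= e)%R.
Proof.
move=> e0; exists (Num.truncn e^-1) => // n /= en.
rewrite invf_ple ?posrE//; apply/ltW; apply: lt_le_trans (truncnS_gt _) _.
by rewrite ler_nat.
Qed.

Lemma cvg_ball_invnS (R : realType) (T : pseudoMetricType R) (u : nat -> T) (x : T) :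
  (forall n, ball x n.+1%:R^-1 (u n)) -> u n @[n --> \oo] --> x.
Proof.
move=> xu; apply/cvg_ballP => e e0; near=> n.
apply: le_ball (xu n); near: n; exact: near_invnS.
Unshelve. all: by end_near. Qed.

Section lower_semicontinuity.
Context (R : realType).

Lemma lsc_liminf_nbhs (X : metricType R) (f : nat -> X -> \bar R) :
  lower_semicontinuous (liminf_nbhs f).
Proof.
move=> x a /liminf_nbhs_gtP[[m r] [/= r0 [b ab bf]]].
exists (ball x (r / 2)); first by apply: nbhsx_ballx; rewrite divr_gt0.
move=> y xy; apply: (lt_le_trans ab).
apply: (@le_liminf_nbhs _ _ _ y b m (r / 2)); first by rewrite divr_gt0.
move=> n z mn yz; apply: bf => //.
by rewrite (splitr r); exact: ball_triangle yz.
Qed.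

Lemma lsc_le_liminf_nbhs (X : metricType R) (f : nat -> X -> \bar R) (F : X -> \bar R) N :
  lower_semicontinuous F -> (forall n y, (N <= n)%N -> F y <= f n y) ->
  forall x, F x <= liminf_nbhs f x.
Proof.
move=> lF Ff x; rewrite leNgt; apply/negP => h.
have [a /andP[ha aF]] := lte_dense h.
have [V xV VF] := lF x a aF.
have /nbhs_ballP[r /= r0 rV] := xV.
move: ha; apply/negP; rewrite -leNgt.
apply: (@le_liminf_nbhs _ _ _ x _ N r) => // n y Nn xy.
by apply: le_trans (Ff n y Nn); apply/ltW/VF/rV.
Qed.

Lemma lsc_measurable d (X : measurableMetricType R d) (F : X -> \bar R) :
  (measurable : set (set X)) = <<s open >> ->
  lower_semicontinuous F -> measurable_fun setT F.
Proof.
move=> mX /lower_semicontinuousP lF.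
apply: (measurability _ (ErealGenOInfty.measurableE R)) => /= _ [_ [a ->] <-].
rewrite setTI preimage_itvoy mX.
exact: sub_sigma_algebra.
Qed.

End lower_semicontinuity.

(** * Limits of near-minimizers *)

Lemma continuous_metric_measurable (R : realType) d (X : measurableMetricType R d)
    (g : X -> R) :
  (measurable : set (set X)) = <<s open >> -> continuous g ->
  measurable_fun setT (fun x => (g x)%:E).
Proof.
move=> mX cg; apply: lsc_measurable mX _; apply/lower_semicontinuousP => a.
rewrite (_ : [set x | _] = g @^-1` [set r | (a < r)%R]).
  by apply: open_comp => //; exact: open_gt.
by apply/seteqP; split => x /=; rewrite lte_fin.
Qed.

Section weak_fatou.
Context (R : realType) (dX dA : measure_display).
Context (X : measurableMetricType R dX) (A : measurableMetricType R dA).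
Variable q : R.-pker (X * A)%type ~> X.
Hypothesis mX : (measurable : set (set X)) = <<s open >>.
Hypothesis q_continuous : weakly_continuous q.

(** Some envelope has an integral above t at z, by monotone convergence. It is bounded
and continuous, so its integral stays above t near z, and it lies below f n for
all large n. Having one neighborhood for all these n is what makes the lemma
applicable at a cluster point. *)
Lemma weak_fatou (f : nat -> X -> \bar R) (z : X * A) (t : R) :
  (forall n y, 0 <= f n y) -> (forall n, measurable_fun setT (f n)) ->
  t%:E < \int[q z]_y liminf_nbhs f y ->
  exists N, \forall z' \near z, forall n, (N <= n)%N -> t%:E < \int[q z']_y f n y.
Proof.
move=> f0 mf tz.
have mg m : measurable_fun setT (fun y => (envelope f m y)%:E).
  by apply: continuous_metric_measurable => //; exact: envelope_continuous.
have g0 m y : 0 <= (envelope f m y)%:E by rewrite lee_fin envelope_ge0.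
have [m tm] : exists m, t%:E < \int[q z]_y (envelope f m y)%:E.
  apply: contrapT => /forallNP h.
  have := @cvg_monotone_convergence _ _ _ (q z) setT measurableT
    (fun m y => (envelope f m y)%:E) mg (fun m y _ => g0 m y).
  have nd y : setT y -> nondecreasing_seq ((fun m y => (envelope f m y)%:E)^~ y).
    by move=> _ m m' mm'; rewrite lee_fin envelope_homo.
  move=> /(_ nd) cvg1.
  move: tz; apply/negP; rewrite -leNgt.
  rewrite (eq_integral (fun y => limn (fun m => (envelope f m y)%:E))); last first.
    by move=> y _; apply/esym/cvg_lim => //; exact: envelope_cvg.
  apply: (cvge_to_le cvg1); apply: nearW => m /=.
  by rewrite leNgt; apply/negP/h.
have gfin z' : \int[q z']_y (envelope f m y)%:E \is a fin_num.
  rewrite ge0_fin_numE ?integral_ge0//.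
  apply: (@le_lt_trans _ _ (\int[kernel_at q z']_y m%:R%:E)).
    by apply: ge0_le_integral => // y _; rewrite lee_fin envelope_len.
  by rewrite integral_prob_cst ltry.
exists m.
have bnd : exists M : R, forall y, (`|envelope f m y| <= M)%R.
  by exists m%:R => y; rewrite ger0_norm ?envelope_ge0// envelope_len.
have /(_ z) cont : continuous (fun z => (\int[q z]_y envelope f m y)%R).
  by apply: q_continuous bnd; exact: envelope_continuous.
have tmR : (t < \int[q z]_y (envelope f m y))%R.
  by rewrite -lte_fin fineK.
have FF : Filter (nbhs z) := @nbhs_filter (X * A)%type z.
apply: (@filterS _ _ FF _ _ _ (@cvgr_gt _ _ _ FF _ _ cont _ tmR)) => z' tz' n mn.
apply: (@lt_le_trans _ _ (\int[q z']_y (envelope f m y)%:E)).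
  by rewrite -(fineK (gfin z')) lte_fin.
by apply: ge0_le_integral => // y _; exact: envelope_lef.
Qed.

End weak_fatou.

Section inf_compactness.
Context (R : realType).

(** An ultrafilter on this set that does not converge to x contains a finite set of
terms of the sequence. *)
Lemma compact_sequence (X : metricType R) (u : nat -> X) (x : X) :
  u n @[n --> \oo] --> x -> compact ([set x] `|` range u).
Proof.
move=> ux; rewrite compact_ultra => F UF FK.
have [Fx|] := pselect (F --> x); first by exists x; split => //; left.
move=> /existsNP[V /not_implyP[xV nFV]].
have [//|FVC] := in_ultra_setVsetC V UF.
have [N _ NV] := ux _ xV.
have : compact (u @` `I_N) by apply/finite_compact/finite_image/finite_II.
rewrite compact_ultra => /(_ F UF).
have FN : F (u @` `I_N).
  apply: filterS (filterI FVC FK) => y [nVy [yx|[n _ yn]]].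
    by exfalso; apply: nVy; rewrite yx; exact: nbhs_singleton.
  exists n => //=; rewrite ltnNge; apply/negP => Nn.
  by apply: nVy; rewrite -yn; exact: NV.
move=> /(_ FN)[p [[n _ <-] Fp]].
by exists (u n); split => //; right; exists n.
Qed.

Lemma prod_hausdorff (X A : metricType R) : hausdorff_space (X * A)%type.
Proof.
move=> [x a] [y b] h.
have hx : x = y.
  apply: metric_hausdorff => U V xU yV.
  have [||[x' a'] [/= Ux Vx]] := h (U `*` setT) (V `*` setT).
  - by exists (U, setT) => //=; split => //; exact: filterT.
  - by exists (V, setT) => //=; split => //; exact: filterT.
  by exists x'; split; [case: Ux|case: Vx].
have ha : a = b.
  apply: metric_hausdorff => U V xU yV.
  have [||[x' a'] [/= Ux Vx]] := h (setT `*` U) (setT `*` V).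
  - by exists (setT, U) => //=; split => //; exact: filterT.
  - by exists (setT, V) => //=; split => //; exact: filterT.
  by exists a'; split; [case: Ux|case: Vx].
by rewrite hx ha.
Qed.

(** A sequence converging to z with costs at most s would lie over a compact set of
states, inside a sublevel set that is compact, hence closed, hence contains z. *)
Lemma K_inf_compact_lsc (X A : metricType R) (c : X * A -> \bar R) z (s : R) :
  K_inf_compact c -> s%:E < c z -> \forall z' \near z, s%:E < c z'.
Proof.
move=> Kc sz; apply: contrapT => h.
have far n : exists z', ball z n.+1%:R^-1 z' /\ c z' <= s%:E.
  apply: contrapT => /forallNP hn; apply: h.
  have : nbhs z (ball z n.+1%:R^-1 : set (X * A)) by apply: nbhsx_ballx.
  apply: filterS => z' zz'; rewrite ltNge; apply/negP => cz'.
  by apply: (hn z').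
pose u n := sval (cid (far n)).
have uP n : ball z n.+1%:R^-1 (u n) /\ c (u n) <= s%:E by rewrite /u; case: cid.
have uz : u n @[n --> \oo] --> z.
  by apply: cvg_ball_invnS => n; case: (uP n).
have u1 : (u n).1 @[n --> \oo] --> z.1 by apply: cvg_comp uz _; exact: cvg_fst.
have L := Kc _ _ (compact_sequence u1) s.
have {}L := L (ex_intro _ z.1 (or_introl erefl)).
have cL := compact_closed (@prod_hausdorff X A) L.
suff [_] : ((([set z.1] `|` range (fun n => (u n).1)) `*` setT) `&`
    [set z' | c z' <= s%:E]) z by rewrite /= leNgt sz.
apply: (closed_cvg _ cL _ _ uz).
apply: nearW => n; split; last by case: (uP n).
by split => //; right; exists n.
Qed.

End inf_compactness.

(** Only real numbers below C and I are tested, so that b = 0 is never multiplied by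
an infinite I. *)
Lemma lee_add_approx (R : realType) (C I : \bar R) (b lam : R) :
  0 <= C -> 0 <= I -> (0 <= b)%R ->
  (forall s t : R, s%:E < C -> t%:E < I -> (s + b * t <= lam)%R) ->
  C + b%:E * I <= lam%:E.
Proof.
move=> C0 I0 b0 key.
have Cle : C <= lam%:E.
  rewrite leNgt; apply/negP => /lte_dense[s /andP[ls sC]].
  rewrite lte_fin in ls.
  have d0 : (0 < (s - lam) / (b + 1))%R by rewrite divr_gt0 ?subr_gt0// ltr_wpDl.
  have tI : (- ((s - lam) / (b + 1)))%:E < I.
    by apply: lt_le_trans I0; rewrite lte_fin oppr_lt0.
  have := key _ _ sC tI.
  have : (b * ((s - lam) / (b + 1)) < s - lam)%R.
    by rewrite mulrCA gtr_pMr ?subr_gt0// ltr_pdivrMr ?ltr_wpDl// mul1r; lra.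
  by rewrite mulrN; lra.
have Cfin : C \is a fin_num by rewrite ge0_fin_numE// (le_lt_trans Cle)// ltry.
rewrite -(fineK Cfin) in Cle key *.
have [->|bpos] := eqVneq b 0%R; first by rewrite mul0e adde0.
have {b0}bpos : (0 < b)%R by rewrite lt_def bpos.
have Ile : I <= ((lam - fine C) / b)%:E.
  rewrite leNgt; apply/negP => /lte_dense[t /andP[t1 tI]].
  move: t1; rewrite lte_fin ltr_pdivrMr// mulrC => t1.
  have sC : (fine C - (b * t - (lam - fine C)) / 2)%:E < (fine C)%:E.
    by rewrite lte_fin; lra.
  by have := key _ _ sC tI; lra.
apply: (@le_trans _ _ ((fine C)%:E + b%:E * ((lam - fine C) / b)%:E)).
  by rewrite leeD2l// lee_pmul2l.
by rewrite -EFinM -EFinD lee_fin mulrCA divff ?gt_eqF// mulr1; lra.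
Qed.

Section near_minimizers.
Context (R : realType) (dX dA : measure_display).
Context (X : measurableMetricType R dX) (A : measurableMetricType R dA).
Variables (q : R.-pker (X * A)%type ~> X) (c : X * A -> \bar R).
Hypothesis mX : (measurable : set (set X)) = <<s open >>.
Hypothesis q_continuous : weakly_continuous q.
Hypothesis c_compact : K_inf_compact c.
Hypothesis c0 : forall z, 0 <= c z.

(** The pairs (u n, a n) stay in a compact sublevel set of c, so they cluster at some
(x, a'), where [K_inf_compact_lsc] and [weak_fatou] bound the two terms of the
cost. Consequences are the attainment and the semicontinuity of one-step minima, the
optimality equation for the limit of value iteration, and the optimality
inequality for average costs. *)
Lemma near_minimizers_limit (f : nat -> X -> \bar R) (beta : nat -> R) (b : R)
    (u : nat -> X) (x : X) (a : nat -> A) (F : set A) (lam : R) :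
  (forall n y, 0 <= f n y) -> (forall n, measurable_fun setT (f n)) ->
  (forall n, (0 <= beta n)%R) -> beta n @[n --> \oo] --> b ->
  u n @[n --> \oo] --> x -> closed F -> (forall n, F (a n)) ->
  (forall e : R, (0 < e)%R -> \forall n \near \oo,
    c (u n, a n) + (beta n)%:E * \int[q (u n, a n)]_y f n y <= (lam + e)%:E) ->
  exists2 a', F a' & c (x, a') + b%:E * \int[q (x, a')]_y liminf_nbhs f y <= lam%:E.
Proof.
move=> f0 mf beta0 betab ux cF Fa cf.
have b0 : (0 <= b)%R by apply: (cvgr_to_ge betab); exact: nearW.
have int0 n z : 0 <= (beta n)%:E * \int[q z]_y f n y.
  by rewrite mule_ge0// ?lee_fin// integral_ge0.
have L : compact ((([set x] `|` range u) `*` setT) `&` [set z' | c z' <= (lam + 1)%:E]).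
  exact: c_compact (ex_intro _ x (or_introl erefl)) (compact_sequence ux) _.
pose z n := (u n, a n).
have zL : (z n @[n --> \oo])
    ((([set x] `|` range u) `*` setT) `&` [set z' | c z' <= (lam + 1)%:E]).
  apply: filterS (cf 1%R ltr01) => n h; split; first by split => //; right; exists n.
  by apply: le_trans h; rewrite leeDl.
have [p [[_ /= cp] clp]] := L (z n @[n --> \oo]) _ zL.
have clnear (V : set (X * A)) M : nbhs p V -> exists2 n, (M <= n)%N & V (z n).
  move=> pV.
  have [|_ [[n Mn <-] Vn]] :=
      clp [set z' | exists2 n, (M <= n)%N & z n = z'] V _ pV.
    by exists M => // n Mn; exists n.
  by exists n.
have px : p.1 = x.
  apply: metric_hausdorff => U V pU xV.
  have [M _ MV] := ux _ xV.
  have pUT : nbhs p (U `*` setT).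
    by exists (U, setT) => //=; split => //; exact: filterT.
  have [n Mn [Un _]] := clnear _ M pUT.
  by exists (u n); split => //; exact: MV.
have pF : F p.2.
  apply: cF => V pV.
  have pTV : nbhs p (setT `*` V).
    by exists (setT, V) => //=; split => //; exact: filterT.
  have [n _ [_ Vn]] := clnear _ 0%N pTV.
  by exists (a n); split.
exists p.2 => //; rewrite -px -surjective_pairing.
apply: lee_add_approx => // [|s t sc tI].
  by apply: integral_ge0 => y _; exact: liminf_nbhs_ge0.
apply/ler_addgt0Pr => e e0.
have e2 : (0 < e / 2)%R by rewrite divr_gt0.
have [N nearI] := weak_fatou mX q_continuous f0 mf tI.
have nearc : \forall z' \near p, s%:E < c z' by exact: K_inf_compact_lsc.
have [M1 _ M1P] := cf _ e2.
have betat : (fun n => beta n * t)%R @ \oo --> (b * t)%R by exact: cvgM betab (cvg_cst _).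
have bt : (b * t - e / 2 < b * t)%R by rewrite gtrBl.
have [M2 _ M2P] := cvgr_gt _ betat _ bt.
have FF : Filter (nbhs p) := @nbhs_filter (X * A)%type p.
have [n Mn [cn In]] := clnear _ (maxn N (maxn M1 M2)) (filterI nearc nearI).
have Nn : (N <= n)%N by lia.
have M1n : (M1 <= n)%N by lia.
have M2n : (M2 <= n)%N by lia.
have /= := M1P n M1n; have /= := M2P n M2n; have /= := In n Nn.
have /= := cn.
rewrite -/(z n) => h1 h2 h3 h4.
have : s%:E + (beta n * t)%:E <= (lam + e / 2)%:E.
  apply: le_trans h4; apply: leeD; first exact: ltW.
  by rewrite EFinM lee_wpmul2l ?lee_fin// ltW.
by rewrite -EFinD lee_fin; lra.
Qed.

End near_minimizers.

(** * Measurable selection from compact-valued maps *)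

Section separation.
Context (R : realType) (d : measure_display) (A : measurableMetricType R d).

(** The preimages in A of the closures of the balls of radius 1 / (n + 1) centered in
a countable dense subset of the ambient Polish space. *)
Lemma closed_separating_sequence : borel_subset_of_polish A ->
  exists F : nat -> set A, (forall j, closed (F j)) /\
    forall a b, a <> b -> exists j, F j a /\ ~ F j b.
Proof.
move=> [_ [P [i [[hP [S cS dS]] injP iopen _]]]].
have /countable_injP[e einj] := cS.
pose s k : set P := [set p | S p /\ e p = k].
pose G k n : set P := [set p | forall q, s k q -> closure (ball q n.+1%:R^-1) p].
have cG k n : closed (G k n).
  have -> : G k n = \bigcap_(q in s k) closure (ball q n.+1%:R^-1).
    by apply/seteqP; split.
  by apply: closed_bigI => q _; exact: closed_closure.
pose kn (j : nat) : nat * nat := odflt (0%N, 0%N) (unpickle j).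
pose F j := i @^-1` G (kn j).1 (kn j).2.
exists F; split.
  move=> j; rewrite -openC.
  apply/iopen; exists (~` G (kn j).1 (kn j).2) => //.
  by rewrite openC.
move=> a b ab.
have /eqP iab : i a <> i b by move=> /injP.
move: hP; rewrite ball_hausdorff => /(_ _ _ iab)[[r1 r2] /= /eqP disj].
have nb : ~ ball (i a) r1%:num (i b).
  by move=> h; have : set0 (i b) by rewrite -disj; split => //; exact: ballxx.
(* three radii separate i a from i b: to the center p, from there to a point z of
   the ball of p, and from z to i b *)
pose n := Num.truncn (3 / r1%:num)%R.
have n3 : (n.+1%:R^-1 + n.+1%:R^-1 + n.+1%:R^-1 <= r1%:num :> R)%R.
  have := @truncnS_gt R (3 / r1%:num)%R; rewrite -/n ltr_pdivrMr// => h.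
  have n0 : (0 < n.+1%:R :> R)%R by [].
  rewrite -(ler_pM2l n0) !mulrDr divff ?gt_eqF//; lra.
have d0 : (0 < n.+1%:R^-1 :> R)%R by [].
have [|p [pint Sp]] := dS (interior (ball (i a) n.+1%:R^-1)) _ (@open_interior _ _).
  by exists (i a); exact: nbhsx_ballx.
have {pint} ap : ball (i a) n.+1%:R^-1 p by exact: interior_subset pint.
exists (pickle (e p, n)); rewrite /F /kn pickleK /=; split.
  move=> q [Sq eq]; have -> : q = p by apply: einj => //; apply/mem_set.
  apply: subset_closure; exact: ball_sym.
move=> /(_ p (conj Sp erefl)) /(_ _ (nbhsx_ballx (i b) _ d0))[z [pz bz]].
apply: nb; apply: le_ball n3 _ _.
exact: ball_triangle (ball_triangle ap pz) (ball_sym bz).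
Qed.

End separation.

Section compact_selection.
Context (R : realType) (dX dA : measure_display).
Context (X : measurableType dX) (A : measurableMetricType R dA).

Definition hit (D : X -> set A) (C : set A) : set X := [set x | D x `&` C !=set0].

Lemma nested_compact_meet (D : nat -> set A) :
  (forall n, compact (D n)) -> (forall n, D n !=set0) ->
  (forall n, D n.+1 `<=` D n) -> (\bigcap_n D n) !=set0.
Proof.
move=> cD D0 DS.
have Dle m n : (m <= n)%N -> D n `<=` D m.
  elim: n => [|n IH]; first by rewrite leqn0 => /eqP ->.
  by rewrite leq_eqVlt => /predU1P[<-//|]; rewrite ltnS => /IH h; exact: subset_trans h.
pose a n := sval (cid (D0 n)).
have aD n : D n (a n) by rewrite /a; case: cid.
have aDm m : (a n @[n --> \oo]) (D m) by exists m => // n /= mn; exact: (Dle _ _ mn).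
have [p [_ clp]] := cD 0%N (a n @[n --> \oo]) _ (aDm 0%N).
exists p => m _; have cl := compact_closed (@metric_hausdorff R A) (cD m).
by apply: cl; move=> V pV; exact: clp.
Qed.

(** Intersect D x with the first set of a separating sequence if the two meet, the
result with the second one, and so on. The sets stay nonempty and compact, and
their hitting sets stay measurable; in the limit a single point is left, which
belongs to a closed set C as soon as all the stages meet C. *)
Lemma measurable_compact_selection (D : X -> set A) :
  borel_subset_of_polish A ->
  (forall x, D x !=set0) -> (forall x, compact (D x)) ->
  (forall C, closed C -> measurable (hit D C)) ->
  exists phi : {mfun X >-> A}, forall x, D x (phi x).
Proof.
move=> A_borel D0 cD mD.
have [F [cF sepF]] := closed_separating_sequence A_borel.
pose shrink j (E : X -> set A) x :=
  if pselect (E x `&` F j !=set0) then E x `&` F j else E x.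
pose E := fix E n := if n is n'.+1 then shrink n' (E n') else D.
have cI B C : compact B -> closed C -> compact (B `&` C).
  exact: compact_closedI.
have cE n x : compact (E n x).
  elim: n => [|n IH] //=; rewrite /shrink; case: pselect => h //.
  exact: cI.
have E0 n x : E n x !=set0.
  by elim: n => [|n IH] //=; rewrite /shrink; case: pselect.
have ES n x : E n.+1 x `<=` E n x.
  by rewrite /= /shrink; case: pselect => h // a [].
have mE n C : closed C -> measurable (hit (E n) C).
  elim: n C => [|n IH] C cC; first exact: mD.
  have -> : hit (E n.+1) C = (hit (E n) (F n) `&` hit (E n) (F n `&` C)) `|`
      (~` hit (E n) (F n) `&` hit (E n) C).
    apply/seteqP; split => x; rewrite /hit /= /shrink; case: pselect => h.
    - by move=> [a [[Ea Fa] Ca]]; left; split => //; exists a.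
    - by move=> [a [Ea Ca]]; right; split => //; exists a.
    - by move=> [[_ [a [Ea [Fa Ca]]]]|[]//]; exists a.
    - by move=> [[]//|[_ [a [Ea Ca]]]]; exists a.
  apply: measurableU; apply: measurableI.
  - exact: IH.
  - by apply: IH; exact: closedI.
  - by apply: measurableC; exact: IH.
  - exact: IH.
have Einf x : (\bigcap_n E n x) !=set0 by exact: nested_compact_meet.
pose phi x := sval (cid (Einf x)).
have phiE x n : E n x (phi x) by rewrite /phi; case: cid => a /= /(_ n I).
have phi_uniq x a : (\bigcap_n E n x) a -> a = phi x.
  move=> Ea; apply: contrapT => /sepF[j [Fa nF]].
  have := phiE x j.+1; rewrite /= /shrink; case: pselect => [_ []//|h _].
  by apply: h; exists a; split => //; exact: Ea.
have phiC C : closed C -> phi @^-1` C = \bigcap_n hit (E n) C.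
  move=> cC; apply/seteqP; split => x /=.
    by move=> Cx n _; exists (phi x).
  move=> h; have [a Ea] : (\bigcap_n (E n x `&` C)) !=set0.
    apply: nested_compact_meet => n; [exact: cI|exact: h|].
    by move=> a [/ES Ea Ca].
  suff -> : phi x = a by case: (Ea 0%N I).
  by apply/esym/phi_uniq => n _; case: (Ea n I).
have mphi : measurable_fun setT phi.
  have [mA _] := A_borel.
  apply: (measurability open) => //.
  move=> _ [U oU <-]; rewrite setTI.
  suff : measurable (phi @^-1` (~` U)).
    by move=> /measurableC; rewrite -preimage_setC setCK.
  rewrite phiC; last by rewrite closedC.
  by apply: bigcap_measurable => // n _; apply: mE; rewrite closedC.
pose phi_mfun : {mfun X >-> A} := mfun_Sub (mem_set mphi).
by exists phi_mfun => x; exact: (phiE x 0%N).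
Qed.

End compact_selection.

(** * One-step minimization *)

Section one_step.
Context (R : realType) (dX dA : measure_display).
Context (X : measurableMetricType R dX) (A : measurableMetricType R dA).
Variables (q : R.-pker (X * A)%type ~> X) (c : X * A -> \bar R).
Hypothesis mX : (measurable : set (set X)) = <<s open >>.
Hypothesis q_continuous : weakly_continuous q.
Hypothesis c_compact : K_inf_compact c.
Hypothesis c0 : forall z, 0 <= c z.
Variables (b : R) (f : X -> \bar R).
Hypothesis b0 : (0 <= b)%R.
Hypothesis f0 : forall y, 0 <= f y.
Hypothesis f_lsc : lower_semicontinuous f.

Definition one_step_cost (z : X * A) : \bar R := c z + b%:E * \int[q z]_y f y.

Definition optimal_cost (F : set A) (x : X) : \bar R :=
  ereal_inf [set one_step_cost (x, a) | a in F].

Let mf : measurable_fun setT f. Proof. exact: lsc_measurable mX f_lsc. Qed.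

Lemma le_one_step_cost z : c z <= one_step_cost z.
Proof. by rewrite leeDl// mule_ge0// ?lee_fin// integral_ge0. Qed.

Lemma liminf_nbhs_cst y : f y <= liminf_nbhs (fun=> f) y.
Proof. exact: (@lsc_le_liminf_nbhs _ _ _ _ 0%N). Qed.

Lemma le_int_liminf z : \int[q z]_y f y <= \int[q z]_y liminf_nbhs (fun=> f) y.
Proof.
apply: ge0_le_integral => //.
  exact: lsc_measurable mX (@lsc_liminf_nbhs _ _ _).
by move=> y _; exact: liminf_nbhs_cst.
Qed.

Lemma one_step_cost_compact x (r : R) : compact [set a | one_step_cost (x, a) <= r%:E].
Proof.
have cx : compact ((([set x] : set X) `*` setT) `&` [set z | c z <= r%:E]).
  by apply: c_compact; [exists x|exact: compact_set1].
have cc : compact (snd @` ((([set x] : set X) `*` setT) `&` [set z | c z <= r%:E])).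
  apply: continuous_compact cx.
  by apply: continuous_subspaceT => z; exact: cvg_snd.
apply: (subclosed_compact _ cc); last first.
  move=> a /= ar; exists (x, a) => //; split => //=.
  exact: le_trans (le_one_step_cost _) ar.
move=> a cla /=; apply: lee_add_approx => //; first exact: integral_ge0.
move=> s t sc tI.
have FF : Filter (nbhs (x, a)) := @nbhs_filter (X * A)%type (x, a).
have tI' : t%:E < \int[q (x, a)]_y liminf_nbhs (fun=> f) y.
  exact: lt_le_trans (le_int_liminf _).
have [N nearI] := weak_fatou mX q_continuous (fun=> f0) (fun=> mf) tI'.
have nearc : \forall z' \near (x, a), s%:E < c z' by exact: K_inf_compact_lsc.
have [[U V] /= [xU aV] UV] := filterI nearc nearI.
have [a' [a'r Va']] := cla V aV.
have [sc' /(_ N (leqnn N)) tI''] := UV (x, a') (conj (nbhs_singleton xU) Va').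
rewrite -lee_fin; apply: le_trans a'r; rewrite EFinD; apply: leeD; first exact: ltW.
by rewrite EFinM lee_wpmul2l ?lee_fin// ltW.
Qed.

Lemma optimal_cost_le (F : set A) x a : F a -> optimal_cost F x <= one_step_cost (x, a).
Proof. by move=> Fa; apply: ereal_inf_lbound; exists a. Qed.

(** Actions that are optimal up to 1 / (n + 1) at u n accumulate. A constant sequence u
gives attainment, and a general one gives lower semicontinuity. *)
Lemma optimal_cost_limit (F : set A) (u : nat -> X) x (lam : R) : closed F ->
  u n @[n --> \oo] --> x -> (forall n, optimal_cost F (u n) <= lam%:E) ->
  exists2 a, F a & one_step_cost (x, a) <= lam%:E.
Proof.
move=> cF ux ulam.
have ex n : exists2 a, F a & one_step_cost (u n, a) <= (lam + n.+1%:R^-1)%:E.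
  have : optimal_cost F (u n) < (lam + n.+1%:R^-1)%:E.
    by apply: le_lt_trans (ulam n) _; rewrite lte_fin ltrDl.
  by move=> /ereal_inf_ltP[_ [a Fa <-] /ltW ?]; exists a.
pose a n := sval (cid2 (ex n)).
have aP n : F (a n) /\ one_step_cost (u n, a n) <= (lam + n.+1%:R^-1)%:E.
  by rewrite /a; case: cid2.
have near_le e : (0 < e)%R -> \forall n \near \oo,
    one_step_cost (u n, a n) <= (lam + e)%:E.
  move=> /near_invnS; apply: filterS => n ne.
  by apply: le_trans (aP n).2 _; rewrite lee_fin lerD2l.
have [a' Fa' a'le] := near_minimizers_limit mX q_continuous c_compact c0
  (fun=> f0) (fun=> mf) (fun=> b0) (cvg_cst b) ux cF (fun n => (aP n).1) near_le.
exists a' => //; apply: le_trans a'le; apply: leeD2l.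
by rewrite lee_wpmul2l ?lee_fin// le_int_liminf.
Qed.

Lemma optimal_cost_attained (F : set A) x (lam : R) : closed F ->
  optimal_cost F x <= lam%:E -> exists2 a, F a & one_step_cost (x, a) <= lam%:E.
Proof. by move=> cF h; apply: (@optimal_cost_limit F (fun=> x)) => //; exact: cvg_cst. Qed.

Lemma optimal_cost_lsc (F : set A) : closed F -> lower_semicontinuous (optimal_cost F).
Proof.
move=> cF x r rx; apply: contrapT => h.
have far n : exists y, ball x n.+1%:R^-1 y /\ optimal_cost F y <= r%:E.
  apply: contrapT => /forallNP hn; apply: h.
  exists (ball x n.+1%:R^-1); first exact: nbhsx_ballx.
  by move=> y xy; rewrite ltNge; apply/negP => yr; apply: (hn y).
pose u n := sval (cid (far n)).
have uP n : ball x n.+1%:R^-1 (u n) /\ optimal_cost F (u n) <= r%:E.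
  by rewrite /u; case: cid.
have ux : u n @[n --> \oo] --> x.
  by apply: cvg_ball_invnS => n; case: (uP n).
have [a Fa ar] := optimal_cost_limit cF ux (fun n => (uP n).2).
by move: rx; rewrite ltNge (le_trans (optimal_cost_le _ Fa)).
Qed.

(** Where theta is finite, the actions that qualify form a compact set, and it meets a
closed set F when the minimum of the cost over F is at most theta. Where theta is
infinite every action qualifies and a fixed one is taken. *)
Lemma measurable_selector (theta : X -> \bar R) : borel_subset_of_polish A ->
  measurable_fun setT theta ->
  (forall x, theta x < +oo -> exists a, one_step_cost (x, a) <= theta x) ->
  exists phi : {mfun X >-> A}, forall x, one_step_cost (x, phi x) <= theta x.
Proof.
move=> A_borel mtheta ex.
pose D x : set A := if theta x < +oo then [set a | one_step_cost (x, a) <= theta x]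
  else [set point].
have fin x : theta x < +oo -> exists r : R, theta x = r%:E.
  move=> /[dup] /ex[a ha] hx; exists (fine (theta x)); rewrite fineK//.
  by rewrite ge0_fin_numE// (le_trans _ ha)// (le_trans _ (le_one_step_cost _)).
have [phi phiD] : exists phi : {mfun X >-> A}, forall x, D x (phi x).
  apply: measurable_compact_selection => //.
  - move=> x; rewrite /D; case: ifPn => [/ex[a ha]|_]; first by exists a.
    by exists point.
  - move=> x; rewrite /D; case: ifPn => [/fin[r ->]|_]; last exact: compact_set1.
    exact: one_step_cost_compact.
  - move=> F cF.
    have mfin : measurable [set x | theta x < +oo].
      by rewrite -(setTI [set x | _]); exact: emeasurable_fun_infty_o.
    have -> : hit D F =
       ([set x | theta x < +oo] `&` [set x | optimal_cost F x <= theta x]) `|`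
       (~` [set x | theta x < +oo] `&` [set x : X | F point]).
      apply/seteqP; split => x; rewrite /hit /D /=.
        case: ifPn => xfin [a [Da Fa]].
          by left; split => //; apply: le_trans Da; exact: optimal_cost_le.
        by right; split; [exact/negP|rewrite -Da].
      move=> [[xfin]|[/negP xfin Fp]]; last by rewrite (negbTE xfin); exists point.
      rewrite xfin; have [r ->] := fin _ xfin.
      by move=> /(optimal_cost_attained cF)[a Fa ar]; exists a.
    apply: measurableU; apply: measurableI => //.
    + rewrite -(setTI [set x | _]); apply: measurable_lee => //.
      exact: lsc_measurable mX (optimal_cost_lsc cF).
    + exact: measurableC.
    + have [Fp|nFp] := pselect (F point).
        by rewrite (_ : [set x | _] = setT)//; apply/seteqP; split.
      by rewrite (_ : [set x | _] = set0)//; apply/seteqP; split.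
exists phi => x; have := phiD x; rewrite /D; case: ifPn => //.
by rewrite ltey negbK => /eqP ->; rewrite leey.
Qed.

End one_step.

(** * Value iteration for the discounted problem *)

Section expected_cost.
Context (R : realType) (dX dA : measure_display).
Context (X : measurableMetricType R dX) (A : measurableMetricType R dA).
Variables (q : R.-pker (X * A)%type ~> X) (c : X * A -> \bar R).
Hypothesis mc : measurable_fun setT c.
Hypothesis c0 : forall z, 0 <= c z.

Definition expected_cost (pi : policy X A) (x : X) (t : nat) : \bar R :=
  \int[traj_prob q pi x]_om c (om t).

Let mct t : measurable_fun setT (fun om : trajectory X A => c (om t)).
Proof. exact: measurableT_comp mc (measurable_coordinate t). Qed.

Lemma expected_cost_ge0 pi x t : 0 <= expected_cost pi x t.
Proof. exact: integral_ge0. Qed.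

Lemma cost_NE N (alpha : R) pi x : (0 <= alpha)%R ->
  cost_N c q N alpha pi x = \sum_(t < N) (alpha ^+ t)%:E * expected_cost pi x t.
Proof.
move=> a0; rewrite /cost_N ge0_integral_sum//.
- by apply: eq_bigr => t _; rewrite ge0_integralZl// lee_fin exprn_ge0.
- by move=> t; apply: measurable_funeM.
- by move=> t om _; rewrite mule_ge0// lee_fin exprn_ge0.
Qed.

Lemma cost_discE (alpha : R) pi x : (0 <= alpha)%R ->
  cost_disc c q alpha pi x = \sum_(0 <= t <oo) (alpha ^+ t)%:E * expected_cost pi x t.
Proof.
move=> a0; rewrite /cost_disc integral_nneseries//.
- by apply: eq_eseriesr => t _; rewrite ge0_integralZl// lee_fin exprn_ge0.
- by move=> t; apply: measurable_funeM.
- by move=> t om _; rewrite mule_ge0// lee_fin exprn_ge0.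
Qed.

Lemma cost_N_le_disc N (alpha : R) pi x : (0 <= alpha)%R ->
  cost_N c q N alpha pi x <= cost_disc c q alpha pi x.
Proof.
move=> a0; rewrite cost_NE// cost_discE//.
rewrite -(big_mkord xpredT (fun t => (alpha ^+ t)%:E * expected_cost pi x t)).
by apply: nneseries_lim_ge => t _ _; rewrite mule_ge0 ?lee_fin ?exprn_ge0 ?expected_cost_ge0.
Qed.

Lemma cost_disc_le (alpha : R) pi x (M : \bar R) : (0 <= alpha)%R ->
  (forall N, cost_N c q N alpha pi x <= M) -> cost_disc c q alpha pi x <= M.
Proof.
move=> a0 h; rewrite cost_discE//; apply: lime_le.
  by apply: is_cvg_nneseries => t _ _; rewrite mule_ge0 ?lee_fin ?exprn_ge0 ?expected_cost_ge0.
by apply: nearW => N; rewrite big_mkord -cost_NE.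
Qed.

Section one_step_expectation.
Variables (b : R) (G : X -> \bar R).
Hypothesis b0 : (0 <= b)%R.
Hypothesis G0 : forall y, 0 <= G y.
Hypothesis mG : measurable_fun setT G.

Lemma one_step_cost_ge0 z : 0 <= one_step_cost q c b G z.
Proof. by rewrite adde_ge0// mule_ge0// ?lee_fin// integral_ge0. Qed.

Lemma measurable_next_integral : measurable_fun setT (fun z => \int[q z]_y G y).
Proof. exact: (measurable_fun_integral_kernel (measurable_kernel q)). Qed.

Lemma measurable_one_step_cost : measurable_fun setT (one_step_cost q c b G).
Proof.
apply: emeasurable_funD => //; apply: measurable_funeM.
exact: measurable_next_integral.
Qed.

Lemma integral_one_step_cost pi x t :
  \int[traj_prob q pi x]_om one_step_cost q c b G (om t) =
  expected_cost pi x t + b%:E * \int[traj_prob q pi x]_om G (om t.+1).1.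
Proof.
have mI : measurable_fun setT (fun om : trajectory X A => \int[q (om t)]_y G y).
  exact: measurableT_comp measurable_next_integral (measurable_coordinate t).
rewrite /one_step_cost ge0_integralD//.
- rewrite ge0_integralZl ?lee_fin//; last by move=> om _; exact: integral_ge0.
  by rewrite integral_next_state.
- by move=> om _; rewrite mule_ge0// ?lee_fin// integral_ge0.
- exact: measurable_funeM.
Qed.

Lemma subsolution_step (H : X -> \bar R) pi x t :
  (forall y, 0 <= H y) -> measurable_fun setT H ->
  (forall z, H z.1 <= one_step_cost q c b G z) ->
  \int[traj_prob q pi x]_om H (om t).1 <=
  expected_cost pi x t + b%:E * \int[traj_prob q pi x]_om G (om t.+1).1.
Proof.
move=> H0 mH Hle; rewrite -integral_one_step_cost; apply: ge0_le_integral => //.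
- exact: measurableT_comp mH (measurable_state t).
- exact: measurableT_comp measurable_one_step_cost (measurable_coordinate t).
Qed.

Lemma supersolution_step (H : X -> \bar R) (phi : {mfun X >-> A}) x t :
  (forall y, 0 <= H y) -> measurable_fun setT H ->
  (forall y, one_step_cost q c b G (y, phi y) <= H y) ->
  expected_cost (det_policy phi) x t +
    b%:E * \int[traj_prob q (det_policy phi) x]_om G (om t.+1).1 <=
  \int[traj_prob q (det_policy phi) x]_om H (om t).1.
Proof.
move=> H0 mH Hle; rewrite -integral_one_step_cost integral_det_action//.
- apply: ge0_le_integral => //.
  + by move=> om _; exact: one_step_cost_ge0.
  + apply: measurableT_comp measurable_one_step_cost _.
    apply/measurable_fun_pair; first exact: (measurable_state t).
    exact: measurableT_comp (measurable_funPT phi) (measurable_state t).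
  + exact: measurableT_comp mH (measurable_state t).
- exact: measurable_one_step_cost.
- exact: one_step_cost_ge0.
Qed.

End one_step_expectation.
End expected_cost.

Section value_iteration.
Context (R : realType) (dX dA : measure_display).
Context (X : measurableMetricType R dX) (A : measurableMetricType R dA).
Variables (q : R.-pker (X * A)%type ~> X) (c : X * A -> \bar R) (alpha : R).
Hypothesis mX : (measurable : set (set X)) = <<s open >>.
Hypothesis A_borel : borel_subset_of_polish A.
Hypothesis mc : measurable_fun setT c.
Hypothesis q_continuous : weakly_continuous q.
Hypothesis c_compact : K_inf_compact c.
Hypothesis c0 : forall z, 0 <= c z.
Hypothesis alpha0 : (0 <= alpha)%R.

Fixpoint value_iter (n : nat) : X -> \bar R :=
  if n is n'.+1 then optimal_cost q c alpha (value_iter n') setT else cst 0.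

Lemma value_iter_ge0 n y : 0 <= value_iter n y.
Proof.
elim: n y => [|n IH] y //=; apply: le_ereal_inf_tmp => _ [a _ <-].
exact: one_step_cost_ge0.
Qed.

Lemma value_iter_lsc n : lower_semicontinuous (value_iter n).
Proof.
elim: n => [|n IH] /=.
  by move=> x a a0; exists setT => //; exact: filterT.
apply: optimal_cost_lsc => //; first exact: value_iter_ge0.
Qed.

Lemma value_iter_measurable n : measurable_fun setT (value_iter n).
Proof. exact: lsc_measurable mX (@value_iter_lsc n). Qed.

Lemma value_iterS n x : value_iter n x <= value_iter n.+1 x.
Proof.
elim: n x => [|n IH] x; first exact: value_iter_ge0.
rewrite [leLHS]/= [leRHS]/=; apply: le_ereal_inf_tmp => _ [a _ <-].
apply: (@le_trans _ _ (one_step_cost q c alpha (value_iter n) (x, a))).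
  exact: optimal_cost_le.
apply: leeD2l; rewrite lee_wpmul2l ?lee_fin//.
apply: ge0_le_integral => //.
- by move=> y _; exact: value_iter_ge0.
- exact: value_iter_measurable.
- exact: (value_iter_measurable n.+1).
Qed.

Definition value_sup (x : X) : \bar R := ereal_sup (range (value_iter^~ x)).

Lemma value_iter_le_sup n x : value_iter n x <= value_sup x.
Proof. by apply: ereal_sup_ubound; exists n. Qed.

Lemma value_sup_ge0 x : 0 <= value_sup x.
Proof. exact: le_trans (value_iter_ge0 0 x) (value_iter_le_sup 0 x). Qed.

Lemma value_sup_lsc : lower_semicontinuous value_sup.
Proof.
move=> x a /ereal_sup_gtP[_ [n _ <-] /value_iter_lsc[V xV Va]].
by exists V => // y /Va h; exact: lt_le_trans (value_iter_le_sup n y).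
Qed.

Lemma value_sup_measurable : measurable_fun setT value_sup.
Proof. exact: lsc_measurable mX value_sup_lsc. Qed.

(** A minimizer for each iterate gives a sequence of near-minimizers, and the joint
lower limit of the iterates is at least their supremum, because they increase and
are lower semicontinuous. *)
Lemma value_sup_attained x : value_sup x < +oo ->
  exists a, one_step_cost q c alpha value_sup (x, a) <= value_sup x.
Proof.
move=> xfin.
have [r xr] : exists r : R, value_sup x = r%:E.
  by exists (fine (value_sup x)); rewrite fineK// ge0_fin_numE// value_sup_ge0.
have ex n : exists2 a : A, setT a & one_step_cost q c alpha (value_iter n) (x, a) <= r%:E.
  apply: optimal_cost_attained => //; [exact: value_iter_ge0|exact: value_iter_lsc|].
  by rewrite -xr -[leLHS]/(value_iter n.+1 x) value_iter_le_sup.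
pose a n := sval (cid2 (ex n)).
have aP n : one_step_cost q c alpha (value_iter n) (x, a n) <= r%:E.
  by rewrite /a; case: cid2.
have near_le e : (0 < e)%R -> \forall n \near \oo,
    c (x, a n) + alpha%:E * \int[q (x, a n)]_y value_iter n y <= (r + e)%:E.
  by move=> e0; apply: nearW => n; apply: le_trans (aP n) _; rewrite lee_fin lerDl ltW.
have [a' _ a'le] := near_minimizers_limit mX q_continuous c_compact c0
  value_iter_ge0 value_iter_measurable (fun=> alpha0) (cvg_cst alpha)
  (cvg_cst x) closedT (fun=> I) near_le.
exists a'; rewrite xr; apply: le_trans a'le; apply: leeD2l.
rewrite lee_wpmul2l ?lee_fin//; apply: ge0_le_integral => //.
- by move=> y _; exact: value_sup_ge0.
- exact: value_sup_measurable.
- exact: lsc_measurable mX (@lsc_liminf_nbhs _ _ _).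
move=> y _; apply: ge_ereal_sup => _ [m _ <-].
apply: (@lsc_le_liminf_nbhs _ _ _ _ m); first exact: value_iter_lsc.
move=> n z; elim: n => [|n IH]; first by rewrite leqn0 => /eqP ->.
rewrite leq_eqVlt => /predU1P[->//|]; rewrite ltnS => /IH h.
exact: le_trans h (value_iterS n z).
Qed.

(** Unrolls the last k iterations along the trajectory; m = 0 is the case of interest,
and a free m is what the induction on k needs. *)
Lemma value_iter_le_cost m k pi x :
  value_iter (m + k) x <= cost_N c q k alpha pi x +
    (alpha ^+ k)%:E * \int[traj_prob q pi x]_om value_iter m (om k).1.
Proof.
rewrite cost_NE//; elim: k m => [|k IH] m.
  rewrite big_ord0 add0e expr0 mul1e addn0 integral_initial_state//.
    exact: value_iter_measurable.
  exact: value_iter_ge0.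
rewrite addnS -addSn; apply: le_trans (IH _) _.
rewrite big_ord_recr /= -addeA; apply: leeD2l.
have ak : 0 <= (alpha ^+ k)%:E by rewrite lee_fin exprn_ge0.
rewrite exprSr EFinM -muleA -ge0_muleDr//; last 2 first.
- exact: expected_cost_ge0.
- by rewrite mule_ge0 ?lee_fin// integral_ge0// => om _; exact: value_iter_ge0.
rewrite lee_wpmul2l//; apply: subsolution_step => //.
- exact: value_iter_ge0.
- exact: value_iter_measurable.
- exact: (value_iter_ge0 m.+1).
- exact: (value_iter_measurable m.+1).
- by move=> [y a] /=; exact: optimal_cost_le.
Qed.

Lemma value_sup_le_disc pi x : value_sup x <= cost_disc c q alpha pi x.
Proof.
apply: ge_ereal_sup => _ [n _ <-].
apply: le_trans (cost_N_le_disc q mc c0 n pi x alpha0).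
have := @value_iter_le_cost 0 n pi x; rewrite add0n => /le_trans; apply.
by rewrite [X in _ * X]integral0 mule0 adde0.
Qed.

Lemma value_sup_policy : exists phi : {mfun X >-> A}, forall x,
  cost_disc c q alpha (det_policy phi) x <= value_sup x.
Proof.
have [phi phiP] := measurable_selector mX q_continuous c_compact c0 alpha0
  value_sup_ge0 value_sup_lsc A_borel value_sup_measurable value_sup_attained.
exists phi => x; apply: cost_disc_le => // N.
suff : cost_N c q N alpha (det_policy phi) x + (alpha ^+ N)%:E *
    \int[traj_prob q (det_policy phi) x]_om value_sup (om N).1 <= value_sup x.
  apply: le_trans; rewrite leeDl// mule_ge0 ?lee_fin ?exprn_ge0//.
  by apply: integral_ge0 => om _; exact: value_sup_ge0.
rewrite cost_NE//; elim: N => [|N IH].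
  rewrite big_ord0 add0e expr0 mul1e integral_initial_state//.
    exact: value_sup_measurable.
  exact: value_sup_ge0.
apply: le_trans IH; rewrite big_ord_recr /= -addeA; apply: leeD2l.
have ak : 0 <= (alpha ^+ N)%:E by rewrite lee_fin exprn_ge0.
rewrite exprSr EFinM -muleA -ge0_muleDr//; last 2 first.
- exact: expected_cost_ge0.
- by rewrite mule_ge0 ?lee_fin// integral_ge0// => om _; exact: value_sup_ge0.
rewrite lee_wpmul2l//; apply: supersolution_step => //.
- exact: value_sup_ge0.
- exact: value_sup_measurable.
- exact: value_sup_ge0.
- exact: value_sup_measurable.
Qed.

(** The iterates are lower bounds for every policy, and a measurable selector of the
minimizing actions for their supremum attains it. *)
Lemma value_discE x : value_disc c q alpha x = value_sup x.
Proof.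
apply/eqP; rewrite eq_le; apply/andP; split.
  have [phi phiP] := value_sup_policy.
  by apply: le_trans (phiP x); apply: ereal_inf_lbound; exists (det_policy phi).
by apply: le_ereal_inf_tmp => _ [pi _ <-]; exact: value_sup_le_disc.
Qed.

End value_iteration.

(** * Upper limits and Abel means *)

Section limsup.
Context (R : realType) (T : topologicalType).
Implicit Types (f g : T -> \bar R) (F : set_system T).

Lemma limf_esup_le_near f F (b : \bar R) :
  F [set x | f x <= b] -> limf_esup f F <= b.
Proof.
move=> Fb; apply: (@le_trans _ _ (ereal_sup (f @` [set x | f x <= b]))).
  by apply: ereal_inf_lbound; exists [set x | f x <= b].
by apply: ge_ereal_sup => _ [x xb <-].
Qed.

Lemma limf_esup_lt_near f F (b : \bar R) : Filter F ->
  limf_esup f F < b -> \forall x \near F, f x < b.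
Proof.
move=> FF /ereal_inf_ltP[_ [V FV <-] Vb].
apply: filterS FV => x Vx; apply: le_lt_trans Vb.
by apply: ereal_sup_ubound; exists x.
Qed.

Lemma le_limf_esup f g F : Filter F ->
  (\forall x \near F, f x <= g x) -> limf_esup f F <= limf_esup g F.
Proof.
move=> FF fg; apply: le_ereal_inf_tmp => _ [V FV <-].
apply: (@le_trans _ _ (ereal_sup (f @` (V `&` [set x | f x <= g x])))).
  by apply: ereal_inf_lbound; exists (V `&` [set x | f x <= g x]) => //; exact: filterI.
apply: ge_ereal_sup => _ [x [Vx fgx] <-]; apply: (le_trans fgx).
by apply: ereal_sup_ubound; exists x.
Qed.

Lemma eq_limf_esup f g F : Filter F ->
  (\forall x \near F, f x = g x) -> limf_esup f F = limf_esup g F.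
Proof.
move=> FF fg; apply/eqP; rewrite eq_le; apply/andP; split; apply: le_limf_esup;
  by apply: filterS fg => x ->.
Qed.

Lemma limf_esup_comp (S : topologicalType) (h : S -> T) f F (G : set_system S) :
  h @ G --> F -> limf_esup (f \o h) G <= limf_esup f F.
Proof.
move=> hGF; apply: le_ereal_inf_tmp => _ [V FV <-].
apply: (@le_trans _ _ (ereal_sup ((f \o h) @` (h @^-1` V)))).
  by apply: ereal_inf_lbound; exists (h @^-1` V) => //; exact: hGF.
apply: ge_ereal_sup => _ [x Vx <-].
by apply: ereal_sup_ubound; exists (h x).
Qed.

Lemma limf_esupD_cst f F (k : R) :
  limf_esup (fun x => f x + k%:E) F = limf_esup f F + k%:E.
Proof.
apply/eqP; rewrite eq_le; apply/andP; split.
  rewrite -leeBlDr//; apply: le_ereal_inf_tmp => _ [V FV <-]; rewrite leeBlDr//.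
  apply: (@le_trans _ _ (ereal_sup ((fun x => f x + k%:E) @` V))).
    by apply: ereal_inf_lbound; exists V.
  apply: ge_ereal_sup => _ [x Vx <-]; apply: leeD2r.
  by apply: ereal_sup_ubound; exists x.
apply: le_ereal_inf_tmp => _ [V FV <-].
apply: (@le_trans _ _ (ereal_sup (f @` V) + k%:E)).
  by apply: leeD2r; apply: ereal_inf_lbound; exists V.
rewrite -leeBrDr//; apply: ge_ereal_sup => _ [x Vx <-]; rewrite leeBrDr//.
by apply: ereal_sup_ubound; exists x.
Qed.

End limsup.

Lemma cvg_at_left1 (R : realType) (alpha : nat -> R) : (forall n, (alpha n < 1)%R) ->
  alpha n @[n --> \oo] --> (1 : R)%R -> alpha n @[n --> \oo] --> (1%R : R)^'-.
Proof.
move=> a1 acvg V Vl; have [N _ NV] := acvg _ Vl.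
by exists N => // n /NV /(_ (a1 n)).
Qed.

Lemma near_left1_range (R : realType) : \forall a \near (1%R : R)^'-, (0 <= a < 1)%R.
Proof.
near=> a; apply/andP; split; last by near: a; exact: nbhs_left_lt.
by near: a; exact: (nbhs_left_ge ltr01).
Unshelve. all: by end_near. Qed.

Section abel.
Context (R : realType).

Lemma abel_bound_real (r : nat -> R) (C s a : R) N : (0 <= a < 1)%R -> (0 <= s)%R ->
  (forall k, \sum_(t < k) r t <= C + s * k%:R)%R ->
  (\sum_(t < N) a ^+ t * r t <= C + s / (1 - a))%R.
Proof.
move=> /andP[a0 a1] s0 rC.
(* summation by parts as an induction: the slack of the last partial sum is carried
   along with weight a ^+ N *)
suff h : (\sum_(t < N) a ^+ t * r t + a ^+ N * (C + s * N%:R - \sum_(t < N) r t)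
    <= C + s * \sum_(t < N) a ^+ t)%R.
  have D0 : (0 <= a ^+ N * (C + s * N%:R - \sum_(t < N) r t))%R.
    by rewrite mulr_ge0 ?exprn_ge0// subr_ge0.
  have G : (s * \sum_(t < N) a ^+ t <= s / (1 - a))%R.
    rewrite ler_wpM2l//.
    have a1' : (0 < 1 - a)%R by rewrite subr_gt0.
    rewrite -[leRHS]mul1r ler_pdivlMr// mulrC -opprB mulNr -subrX1 opprB.
    by rewrite gerBl exprn_ge0.
  lra.
elim: N => [|N IH].
  by rewrite !big_ord0 expr0; lra.
rewrite !big_ord_recr /=.
set S := (\sum_(i < N) r i)%R in IH *; set Sa := (\sum_(i < N) a ^+ i * r i)%R in IH *.
set G := (\sum_(i < N) a ^+ i)%R in IH *.
have D' : (0 <= C + s * N.+1%:R - (S + r N))%R.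
  by rewrite subr_ge0; have := rC N.+1; rewrite big_ord_recr.
have aN : (0 <= a ^+ N)%R by rewrite exprn_ge0.
rewrite exprSr -addn1 natrD mulrDr mulr1 in D' *.
have : (0 <= (1 - a) * (a ^+ N * (C + (s * N%:R + s) - (S + r N))))%R.
  by rewrite !mulr_ge0// subr_ge0 ltW.
move: IH; nra.
Qed.

Lemma abel_bound (e : nat -> \bar R) (C s a : R) N : (0 <= a < 1)%R -> (0 <= s)%R ->
  (forall t, 0 <= e t) -> (forall k, \sum_(t < k) e t <= (C + s * k%:R)%:E) ->
  \sum_(t < N) (a ^+ t)%:E * e t <= (C + s / (1 - a))%:E.
Proof.
move=> a01 s0 e0 eC.
have efin t : e t \is a fin_num.
  rewrite ge0_fin_numE//; apply: (@le_lt_trans _ _ (\sum_(i < t.+1) e i)).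
    by rewrite big_ord_recr leeDr// sume_ge0.
  by apply: le_lt_trans (eC _) _; rewrite ltry.
rewrite (eq_bigr (fun t : 'I_N => (a ^+ t * fine (e t))%:E)); last first.
  by move=> t _; rewrite EFinM fineK.
rewrite sumEFin lee_fin.
apply: (abel_bound_real (r := fun t => fine (e t))) => // k.
by rewrite -lee_fin -sumEFin; under eq_bigr do rewrite fineK//.
Qed.

End abel.

(** * The vanishing discount limit for nonnegative costs *)

Section tauberian.
Context (R : realType) (dX dA : measure_display).
Context (X : measurableMetricType R dX) (A : measurableMetricType R dA).
Variables (q : R.-pker (X * A)%type ~> X) (c : X * A -> \bar R).
Hypothesis mc : measurable_fun setT c.
Hypothesis c0 : forall z, 0 <= c z.

Lemma cost_N1E N pi x : cost_N c q N 1%R pi x = \sum_(t < N) expected_cost q c pi x t.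
Proof. by rewrite cost_NE//; apply: eq_bigr => t _; rewrite expr1n mul1e. Qed.

Lemma cost_avg_lt_bound pi x (s : R) : cost_avg c q pi x < s%:E ->
  (0 <= s)%R /\ exists C : R, (0 <= C)%R /\
    forall N, \sum_(t < N) expected_cost q c pi x t <= (C + s * N%:R)%:E.
Proof.
move=> /limf_esup_lt_near; have e0 := expected_cost_ge0 q c0 pi x.
pose S N := \sum_(t < N) expected_cost q c pi x t.
have S0 N : 0 <= S N by exact: sume_ge0.
move=> [N0 _ NS].
have SN N : (N0 < N)%N -> S N <= (s * N%:R)%:E.
  move=> N0N; have /= := NS N (ltnW N0N); rewrite cost_N1E -/(S N) => h.
  have Npos : (0 < N%:R :> R)%R by rewrite ltr0n; exact: leq_trans N0N.
  rewrite EFinM muleC -(@lee_pmul2l _ N%:R^-1%:E)//; last by rewrite lte_fin invr_gt0.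
  by rewrite -!EFinM mulrA mulVf ?gt_eqF// mul1r ltW.
have s0 : (0 <= s)%R.
  have /= := NS N0 (leqnn _); rewrite cost_N1E -/(S N0) => h.
  rewrite -lee_fin; apply: le_trans (ltW h).
  by rewrite mule_ge0 ?lee_fin ?invr_ge0.
(* this constant covers the partial sums up to N0 *)
split => //; exists (s * N0.+1%:R)%R; split; first by rewrite mulr_ge0.
move=> N; have [NN0|NN0] := leqP N N0.
  apply: (@le_trans _ _ (S N0.+1)).
    rewrite /S -!(big_mkord xpredT (expected_cost q c pi x)).
    by apply: lee_sum_nneg_natr => //; exact: leqW.
  apply: le_trans (SN _ (ltnSn _)) _.
  by rewrite lee_fin lerDl mulr_ge0.
by apply: le_trans (SN _ NN0) _; rewrite lee_fin lerDr mulr_ge0.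
Qed.

Lemma cost_avg_lt_disc pi x (s : R) : cost_avg c q pi x < s%:E ->
  exists C : R, (0 <= C)%R /\ forall a : R, (0 <= a < 1)%R ->
    cost_disc c q a pi x <= (C + s / (1 - a))%:E.
Proof.
move=> /cost_avg_lt_bound[s0 [C [C0 CS]]]; exists C; split => // a a01.
have a0 : (0 <= a)%R by case/andP: a01.
apply: cost_disc_le => // N; rewrite cost_NE//.
by apply: abel_bound => //; exact: expected_cost_ge0.
Qed.

(** For s above the average cost, [cost_avg_lt_disc] bounds (1 - a) times the
discounted cost by (1 - a) C + s, which tends to s. *)
Lemma limsup_value_disc_le_avg pi x :
  limf_esup (fun a : R => (1 - a)%:E * value_disc c q a x) (1%R : R)^'- <=
  cost_avg c q pi x.
Proof.
rewrite leNgt; apply/negP => /lte_dense[s /andP[/cost_avg_lt_disc[C [C0 CS]]]].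
apply/negP; rewrite -leNgt; apply/lee_addgt0Pr => e e0; apply: limf_esup_le_near.
have lt1 : (1 - e / (C + 1) < 1)%R by rewrite gtrBl divr_gt0// ltr_wpDl.
near=> a => /=.
have a01 : (0 <= a < 1)%R by near: a; exact: near_left1_range.
have a1 : (0 < 1 - a)%R by rewrite subr_gt0; case/andP: a01.
apply: (@le_trans _ _ ((1 - a)%:E * (C + s / (1 - a))%:E)).
  rewrite lee_pmul2l//; apply: le_trans (CS a a01).
  by apply: ereal_inf_lbound; exists pi.
rewrite -EFinM -EFinD lee_fin.
have -> : ((1 - a) * (C + s / (1 - a)) = s + (1 - a) * C)%R.
  by field; rewrite gt_eqF.
rewrite lerD2l.
have ae : (1 - e / (C + 1) <= a)%R by near: a; exact: (nbhs_left_ge lt1).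
apply: (@le_trans _ _ ((1 - a) * (C + 1))%R).
  by apply: ler_wpM2l; [exact: ltW|rewrite lerDl].
rewrite -ler_pdivlMr ?ltr_wpDl//; lra.
Unshelve. all: by end_near. Qed.

End tauberian.

Section nonnegative_cost.
Context (R : realType) (dX dA : measure_display).
Context (X : measurableMetricType R dX) (A : measurableMetricType R dA).
Variables (q : R.-pker (X * A)%type ~> X) (c : X * A -> \bar R) (alpha : nat -> R).
Hypothesis mX : (measurable : set (set X)) = <<s open >>.
Hypothesis A_borel : borel_subset_of_polish A.
Hypothesis mc : measurable_fun setT c.
Hypothesis c0 : forall z, 0 <= c z.
Hypothesis c_compact : K_inf_compact c.
Hypothesis q_continuous : weakly_continuous q.
Hypothesis alpha_range : forall n, (0 <= alpha n < 1)%R.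
Hypothesis alpha_cvg : alpha n @[n --> \oo] --> (1 : R)%R.
Hypothesis w_star_lty : w_star c q < +oo.
Hypothesis u_liminf_lty : forall x, limn_einf (fun n => u_disc c q (alpha n) x) < +oo.

Let value_lsc a : (0 <= a)%R -> lower_semicontinuous (value_disc c q a).
Proof.
move=> a0; rewrite (_ : value_disc c q a = value_sup q c a).
  exact: value_sup_lsc.
by apply/funext => x; exact: value_discE.
Qed.

Let value_ge0 a x : (0 <= a)%R -> 0 <= value_disc c q a x.
Proof. by move=> a0; rewrite value_discE// value_sup_ge0. Qed.

Lemma m_disc_fin a : (0 <= a < 1)%R -> m_disc c q a \is a fin_num.
Proof.
move=> a01; have a0 : (0 <= a)%R by case/andP: a01.
rewrite ge0_fin_numE; last by apply: le_ereal_inf_tmp => _ [x _ <-]; exact: value_ge0.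
have /ereal_inf_ltP[_ [x _ <-] /ereal_inf_ltP[_ [pi _ <-] wpi]] := w_star_lty.
have [s /andP[/(cost_avg_lt_disc mc c0)[C [C0 CS]] _]] := lte_dense wpi.
apply: (@le_lt_trans _ _ (value_disc c q a x)); first by apply: ereal_inf_lbound; exists x.
apply: (@le_lt_trans _ _ (cost_disc c q a pi x)); first by apply: ereal_inf_lbound; exists pi.
by apply: le_lt_trans (CS a a01) _; rewrite ltry.
Qed.

Let m_ge0 a : (0 <= a)%R -> 0 <= m_disc c q a.
Proof. by move=> a0; apply: le_ereal_inf_tmp => _ [x _ <-]; exact: value_ge0. Qed.

Lemma u_disc_ge0 a x : (0 <= a < 1)%R -> 0 <= u_disc c q a x.
Proof.
move=> a01; rewrite /u_disc sube_ge0 ?m_disc_fin//.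
by apply: ereal_inf_lbound; exists x.
Qed.

Lemma u_discK a x : (0 <= a < 1)%R -> u_disc c q a x + m_disc c q a = value_disc c q a x.
Proof. by move=> a01; rewrite /u_disc subeK// m_disc_fin. Qed.

Lemma u_disc_measurable a : (0 <= a < 1)%R -> measurable_fun setT (u_disc c q a).
Proof.
move=> a01; apply: emeasurable_funB => //.
by apply: lsc_measurable mX _; apply: value_lsc; case/andP: a01.
Qed.

(** The discounted optimality equation with [m_disc] subtracted on both sides. *)
Lemma discounted_optimality a x : (0 <= a < 1)%R -> u_disc c q a x < +oo ->
  exists b, one_step_cost q c a (u_disc c q a) (x, b) <=
    (1 - a)%:E * m_disc c q a + u_disc c q a x.
Proof.
move=> a01 ux; have a0 : (0 <= a)%R by case/andP: a01.
have mfin := m_disc_fin a01; have um0 := m_ge0 a0.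
have vE y : value_sup q c a y = u_disc c q a y + m_disc c q a.
  by rewrite u_discK// value_discE.
have vx : value_sup q c a x < +oo.
  by rewrite vE lte_add_pinfty// ltey_eq mfin.
have [b hb] := value_sup_attained mX q_continuous c_compact c0 a0 vx.
exists b; move: hb; rewrite /one_step_cost.
under eq_integral do rewrite vE.
rewrite vE ge0_integralD//; last 2 first.
- by move=> y _; exact: u_disc_ge0.
- exact: u_disc_measurable.
rewrite -[in X in _ + X](fineK mfin) integral_cst//= prob_kernel mule1.
set I := \int[_]_y _; have I0 : 0 <= I by apply: integral_ge0 => y _; exact: u_disc_ge0.
rewrite fineK// ge0_muleDr// addeA => h.
rewrite -(leeD2rE _ _ (_ : a%:E * m_disc c q a \is a fin_num)); last by rewrite fin_numM.
apply: (le_trans h).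
have mE : (1 - a)%:E * m_disc c q a + a%:E * m_disc c q a = m_disc c q a.
  rewrite -(fineK mfin) -!EFinM -EFinD; congr (_%:E); ring.
by rewrite [leRHS]addeAC mE addeC.
Qed.

Let Filter_left : Filter ((1%R : R)^'-).
Proof. exact: at_left_proper_filter. Qed.

Let alpha_left : alpha n @[n --> \oo] --> (1%R : R)^'-.
Proof. by apply: cvg_at_left1 => // n; case/andP: (alpha_range n). Qed.

Let L x := limf_esup (fun a : R => (1 - a)%:E * value_disc c q a x) (1%R : R)^'-.
Let Lseq x := limn_esup (fun n => (1 - alpha n)%:E * value_disc c q (alpha n) x).
Let u := u_lim c q alpha.

Let m_le_value (a : R) x : (0 <= a < 1)%R ->
  (1 - a)%:E * m_disc c q a <= (1 - a)%:E * value_disc c q a x.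
Proof.
move=> /andP[a0 a1]; apply: lee_wpmul2l; first by rewrite lee_fin subr_ge0 ltW.
by apply: ereal_inf_lbound; exists x.
Qed.

Let w_bar_seq_le : w_bar_seq c q alpha <= w_bar c q.
Proof. exact: limf_esup_comp alpha_left. Qed.

Let w_bar_le_L x : w_bar c q <= L x.
Proof.
apply: le_limf_esup; near=> a; apply: m_le_value.
by near: a; exact: near_left1_range.
Unshelve. all: by end_near. Qed.

Let w_bar_seq_le_Lseq x : w_bar_seq c q alpha <= Lseq x.
Proof. by apply: le_limf_esup; apply: nearW => n; exact: m_le_value. Qed.

Let Lseq_le_L x : Lseq x <= L x.
Proof.
exact: (limf_esup_comp (fun a : R => (1 - a)%:E * value_disc c q a x) alpha_left).
Qed.

Let L_le_avg x : L x <= value_avg c q x.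
Proof. by apply: le_ereal_inf_tmp => _ [pi _ <-]; exact: limsup_value_disc_le_avg. Qed.

Lemma w_bar_seq_ge0 : 0 <= w_bar_seq c q alpha.
Proof.
apply: limf_esup_ge0; first by case=> N _ /(_ N) /=; apply.
move=> n; have /andP[a0 a1] := alpha_range n.
by apply: mule_ge0; [rewrite lee_fin subr_ge0 ltW|exact: m_ge0].
Qed.

Lemma w_bar_seq_fin : w_bar_seq c q alpha \is a fin_num.
Proof.
rewrite ge0_fin_numE ?w_bar_seq_ge0//.
have /ereal_inf_ltP[_ [x _ <-] wx] := w_star_lty.
apply: le_lt_trans wx; apply: le_trans (L_le_avg x).
exact: le_trans w_bar_seq_le (w_bar_le_L x).
Qed.

Lemma u_lim_ge0 x : 0 <= u x.
Proof. by apply: liminf_nbhs_ge0 => n y; exact: u_disc_ge0. Qed.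

Lemma u_lim_lsc : lower_semicontinuous u.
Proof. exact: lsc_liminf_nbhs. Qed.

Lemma u_lim_lty x : u x < +oo.
Proof.
apply: le_lt_trans (u_liminf_lty x).
rewrite -[leRHS]/(limf_einf (fun n => u_disc c q (alpha n) x) \oo) limf_einfE.
apply: ge_ereal_sup => _ [[m r] /= r0 <-].
apply: (@le_trans _ _ (ereal_inf ((fun n => u_disc c q (alpha n) x) @` [set n | (m <= n)%N]))).
  apply: le_ereal_inf_tmp => _ [n /= mn <-].
  by apply: ereal_inf_lbound; exists (n, x) => //=; split => //; exact: ballxx.
by apply: ereal_sup_ubound; exists [set n | (m <= n)%N] => //; exists m.
Qed.

Let u_fin x : u x \is a fin_num.
Proof. by rewrite ge0_fin_numE ?u_lim_ge0// u_lim_lty. Qed.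

(** The lower limit u x is approached at points y_k -> x and indices n_k. The indices
need not increase: k <= n_k is enough for the lower limit along them to be at
least u. *)
Lemma average_optimality_point x :
  exists a, one_step_cost q c 1 u (x, a) <= w_bar_seq c q alpha + u x.
Proof.
pose ud n := u_disc c q (alpha n).
have ex k : exists ny : nat * X, [/\ (k <= ny.1)%N, ball x k.+1%:R^-1 ny.2 &
    ud ny.1 ny.2 < (fine (u x) + k.+1%:R^-1)%:E].
  have : ereal_inf [set ud nz.1 nz.2 | nz in
      [set nz | (k <= nz.1)%N /\ ball x (k.+1%:R^-1 : R) nz.2]] <
      (fine (u x) + k.+1%:R^-1)%:E.
    apply: (@le_lt_trans _ _ (u x)); last by rewrite -(fineK (u_fin x)) lte_fin ltrDl.
    by apply: ereal_sup_ubound; exists (k, k.+1%:R^-1%R) => //=.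
  by move=> /ereal_inf_ltP[_ [[n y] [/= kn xy] <-] h]; exists (n, y).
pose n_ k := (sval (cid (ex k))).1; pose y_ k := (sval (cid (ex k))).2.
have nyP k : [/\ (k <= n_ k)%N, ball x k.+1%:R^-1 (y_ k) &
    ud (n_ k) (y_ k) < (fine (u x) + k.+1%:R^-1)%:E].
  by rewrite /n_ /y_; case: cid.
have aex k : exists a, one_step_cost q c (alpha (n_ k)) (ud (n_ k)) (y_ k, a) <=
    (1 - alpha (n_ k))%:E * m_disc c q (alpha (n_ k)) + ud (n_ k) (y_ k).
  apply: discounted_optimality => //.
  by have [_ _ h] := nyP k; apply: lt_trans h _; rewrite ltry.
pose a_ k := sval (cid (aex k)).
have aP k : one_step_cost q c (alpha (n_ k)) (ud (n_ k)) (y_ k, a_ k) <=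
    (1 - alpha (n_ k))%:E * m_disc c q (alpha (n_ k)) + ud (n_ k) (y_ k).
  by rewrite /a_; case: cid.
have yx : y_ k @[k --> \oo] --> x.
  by apply: cvg_ball_invnS => k; case: (nyP k).
have noo : n_ k @[k --> \oo] --> \oo.
  move=> V [N _ NV]; exists N => // k /= Nk; apply: NV => /=.
  by have [kn _ _] := nyP k; exact: leq_trans Nk kn.
have beta1 : alpha (n_ k) @[k --> \oo] --> (1 : R)%R by exact: cvg_comp noo alpha_cvg.
have wfin := w_bar_seq_fin.
pose lam := (fine (w_bar_seq c q alpha) + fine (u x))%R.
have near_le (e : R) : (0 < e)%R -> \forall k \near \oo,
    c (y_ k, a_ k) + (alpha (n_ k))%:E * \int[q (y_ k, a_ k)]_y ud (n_ k) y <= (lam + e)%:E.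
  move=> e0; have e2 : (0 < e / 2)%R by rewrite divr_gt0.
  have : w_bar_seq c q alpha < (fine (w_bar_seq c q alpha) + e / 2)%:E.
    by rewrite -[ltLHS]fineK// lte_fin ltrDl.
  move=> /limf_esup_lt_near[N _ NP].
  have [M _ MP] := near_invnS e2.
  exists (maxn N M) => // k /=; rewrite geq_max => /andP[Nk Mk].
  apply: le_trans (aP k) _.
  have [kn _ /ltW uk] := nyP k.
  have /= /ltW mk := NP (n_ k) (leq_trans Nk kn).
  apply: le_trans (leeD mk uk) _.
  rewrite -EFinD lee_fin /lam; have /= := MP k Mk.
  move: (k.+1%:R^-1)%R => z; lra.
have [a _ ale] := near_minimizers_limit mX q_continuous c_compact c0
  (fun k y => u_disc_ge0 y (alpha_range (n_ k)))
  (fun k => u_disc_measurable (alpha_range (n_ k)))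
  (fun k => proj1 (andP (alpha_range (n_ k)))) beta1 yx closedT (fun=> I) near_le.
exists a; rewrite -(fineK wfin) -(fineK (u_fin x)) -EFinD.
apply: le_trans ale; rewrite /one_step_cost.
apply: leeD2l; apply: lee_wpmul2l; first by rewrite lee_fin.
apply: ge0_le_integral.
- exact: measurableT.
- by move=> y _; exact: u_lim_ge0.
- exact: lsc_measurable mX u_lim_lsc.
- exact: lsc_measurable mX (@lsc_liminf_nbhs _ _ _).
move=> y _; apply: ge_ereal_sup => _ [[m r] /= r0 <-].
apply: (@le_liminf_nbhs _ _ _ _ _ m r) => // k z mk yz.
apply: ereal_inf_lbound; exists (n_ k, z) => //=; split => //.
by have [kn _ _] := nyP k; exact: leq_trans mk kn.
Qed.

Lemma average_optimality_policy : exists phi : {mfun X >-> A},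
  forall x, one_step_cost q c 1 u (x, phi x) <= w_bar_seq c q alpha + u x.
Proof.
have mu := lsc_measurable mX u_lim_lsc.
apply: (measurable_selector mX q_continuous c_compact c0 ler01 u_lim_ge0 u_lim_lsc) => //.
  by apply: emeasurable_funD.
by move=> x _; exact: average_optimality_point.
Qed.

(** Each step costs at most w_bar_seq plus the decrease of the expectation of u, so N
steps cost at most N w_bar_seq + u x. *)
Lemma cost_avg_le_w_bar_seq (phi : {mfun X >-> A}) x :
  (forall y, one_step_cost q c 1 u (y, phi y) <= w_bar_seq c q alpha + u y) ->
  cost_avg c q (det_policy phi) x <= w_bar_seq c q alpha.
Proof.
move=> phiP.
have mu := lsc_measurable mX u_lim_lsc.
have wfin := w_bar_seq_fin.
set w := fine (w_bar_seq c q alpha).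
have wE : w_bar_seq c q alpha = w%:E by rewrite fineK.
have w0 : 0 <= w%:E by rewrite -wE w_bar_seq_ge0.
pose Eu N := \int[traj_prob q (det_policy phi) x]_om u (om N).1.
have Eu0 N : 0 <= Eu N by apply: integral_ge0 => om _; exact: u_lim_ge0.
have e0 := expected_cost_ge0 q c0 (det_policy phi) x.
have bound N : \sum_(t < N) expected_cost q c (det_policy phi) x t + Eu N <=
    (w * N%:R)%:E + u x.
  elim: N => [|N IH].
    by rewrite big_ord0 mulr0 !add0e /Eu integral_initial_state//; exact: u_lim_ge0.
  have step : expected_cost q c (det_policy phi) x N + Eu N.+1 <= w%:E + Eu N.
    have -> : w%:E + Eu N =
        \int[traj_prob q (det_policy phi) x]_om (w%:E + u (om N).1).
      rewrite ge0_integralD//.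
      - by rewrite integral_prob_cst.
      - by move=> om _; exact: u_lim_ge0.
      - exact: measurableT_comp mu (measurable_state N).
    rewrite -[X in _ + X]mul1e.
    apply: (supersolution_step mc c0 ler01 u_lim_ge0 mu (H := fun y => w%:E + u y)).
    - by move=> y; rewrite adde_ge0// u_lim_ge0.
    - exact: emeasurable_funD.
    - by move=> y; rewrite -wE.
  rewrite big_ord_recr /= -addeA; apply: le_trans (leeD2l _ step) _.
  rewrite addeCA.
  apply: le_trans (leeD2l _ IH) _.
  by rewrite addeA -EFinD -natr1 mulrDr mulr1 (addrC w).
rewrite wE; apply/lee_addgt0Pr => e epos; apply: limf_esup_le_near.
exists (Num.truncn (fine (u x) / e)).+1 => // N /= hN; rewrite cost_N1E//.
have Npos : (0 < N%:R :> R)%R by rewrite ltr0n; exact: leq_trans hN.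
have : \sum_(t < N) expected_cost q c (det_policy phi) x t <= (w * N%:R + fine (u x))%:E.
  rewrite EFinD fineK//; apply: le_trans (bound N).
  by rewrite leeDl.
move=> h; apply: (@le_trans _ _ (N%:R^-1%:E * (w * N%:R + fine (u x))%:E)).
  by apply: lee_wpmul2l => //; rewrite lee_fin invr_ge0 ltW.
rewrite -EFinM -EFinD lee_fin mulrC ler_pdivrMr// mulrDl lerD2l.
have uN : (fine (u x) / e <= N%:R)%R.
  apply: (@le_trans _ _ (Num.truncn (fine (u x) / e)).+1%:R).
    exact/ltW/truncnS_gt.
  by rewrite ler_nat.
by rewrite mulrC -ler_pdivrMr.
Qed.

(** The inequalities collected above form a circle through [value_avg] and the average
cost of the policy, so all of them are equalities. *)
Theorem average_cost_optimality_nonneg : exists phi : {mfun X >-> A},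
  [/\ (forall x, c (x, phi x) + \int[q (x, phi x)]_y u y <= w_bar c q + u x),
      lower_semicontinuous u
    & forall x,
      [/\ value_avg c q x = w_star c q,
          cost_avg c q (det_policy phi) x = w_star c q,
          Lseq x = w_star c q,
          L x = w_star c q
        & w_bar c q = w_star c q /\ w_bar_seq c q alpha = w_star c q]].
Proof.
have [phi phiP] := average_optimality_policy.
have avg_le x := cost_avg_le_w_bar_seq x phiP.
have value_le x : value_avg c q x <= cost_avg c q (det_policy phi) x.
  by apply: ereal_inf_lbound; exists (det_policy phi).
have w_le x := w_bar_le_L x.
have value_w x : value_avg c q x = w_bar_seq c q alpha.
  apply/eqP; rewrite eq_le (le_trans (value_le x) (avg_le x)) /=.
  exact: le_trans w_bar_seq_le (le_trans (w_le x) (L_le_avg x)).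
have wstar : w_star c q = w_bar_seq c q alpha.
  have -> : w_star c q = ereal_inf [set w_bar_seq c q alpha].
    congr ereal_inf; apply/seteqP; split => [_ [x _ <-]|_ ->] /=.
      exact: value_w.
    by exists point.
  by rewrite ereal_inf1.
have sandwich (y : \bar R) x : w_bar_seq c q alpha <= y -> y <= value_avg c q x ->
    y = w_star c q.
  by move=> h1; rewrite value_w => h2; rewrite wstar; apply/eqP; rewrite eq_le h2.
exists phi; split.
- move=> x; apply: le_trans (leeD2r _ w_bar_seq_le).
  by have := phiP x; rewrite /one_step_cost mul1e.
- exact: u_lim_lsc.
move=> x; split.
- by rewrite value_w.
- apply: (sandwich _ x); first by rewrite -(value_w x).
  by rewrite value_w.
- by apply: (sandwich _ x) => //; exact: le_trans (Lseq_le_L x) (L_le_avg x).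
- by apply: (sandwich _ x) => //; exact: le_trans w_bar_seq_le (w_le x).
- split; last by [].
  by apply: (sandwich _ x) => //; exact: le_trans (w_le x) (L_le_avg x).
Qed.

End nonnegative_cost.

(** * Costs bounded below *)

(** The integral of g may be infinite; the negative part of g - k is bounded by k, so
it can be moved to the other side. *)
Lemma integralD_cst_probability d (T : measurableType d) (R : realType)
    (P : probability T R) (g : T -> \bar R) (k : R) : (0 <= k)%R ->
  measurable_fun setT g -> (forall x, 0 <= g x) ->
  \int[P]_x (g x + (- k)%:E) = \int[P]_x g x + (- k)%:E.
Proof.
move=> k0 mg g0; pose h x := g x + (- k)%:E.
have mh : measurable_fun setT h by exact: emeasurable_funD.
have hE x : h^\+ x + k%:E = g x + h^\- x.
  rewrite funeposE funenegE /h; case: (g x) (g0 x) => [r|_|//] /=.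
    rewrite lee_fin => r0; rewrite -!EFin_max -!EFinD; congr (_%:E).
    by rewrite /Order.max; case: ifPn; case: ifPn; rewrite -?leNgt; lra.
  by rewrite maxye maxNye.
have hk x : h^\- x <= k%:E.
  rewrite funenegE /h; case: (g x) (g0 x) => [r|_|//] /=.
    rewrite lee_fin => r0; rewrite -EFin_max lee_fin ge_max k0 andbT.
    lra.
  by rewrite ge_max leNye lee_fin k0.
have Ifin : \int[P]_x h^\- x \is a fin_num.
  rewrite ge0_fin_numE; last exact: integral_ge0.
  apply: (@le_lt_trans _ _ (\int[P]_x k%:E)).
    by apply: ge0_le_integral => //; exact: measurable_funeneg.
  by rewrite integral_prob_cst ltry.
have : \int[P]_x h^\+ x + k%:E = \int[P]_x g x + \int[P]_x h^\- x.
  rewrite -[X in _ + X = _](integral_prob_cst P) -!ge0_integralD//.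
  - by apply: eq_integral => x _; exact: hE.
  - exact: measurable_funeneg.
  - exact: measurable_funepos.
have -> : \int[P]_x (g x + (- k)%:E) = \int[P]_x h^\+ x - \int[P]_x h^\- x.
  by rewrite -[LHS]/(\int[P]_x h x) integralE.
rewrite -(fineK Ifin).
case: (\int[P]_x h^\+ x) => [r| |]; case: (\int[P]_x g x) => [s| |] //=.
by move=> [rs]; congr (_%:E); lra.
Qed.

Section sums.
Context (R : realType).

Lemma sum_weighted_shift (e : nat -> \bar R) (a M : R) N :
  (0 <= a)%R -> (forall t, 0 <= e t) ->
  \sum_(t < N) (a ^+ t)%:E * (e t + (- M)%:E) =
  \sum_(t < N) (a ^+ t)%:E * e t + (- (\sum_(t < N) M * a ^+ t)%R)%:E.
Proof.
move=> a0 e0; elim: N => [|N IH]; first by rewrite !big_ord0 oppr0 adde0.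
rewrite !big_ord_recr /= {}IH opprD EFinD addeACA; congr (_ + _).
rewrite muleDr//; last by rewrite fin_num_adde_defl.
by rewrite -EFinM mulrN mulrC.
Qed.

Lemma eseries_weighted_shift (e : nat -> \bar R) (a M : R) :
  (0 <= a < 1)%R -> (forall t, 0 <= e t) ->
  \sum_(0 <= t <oo) (a ^+ t)%:E * (e t + (- M)%:E) =
  \sum_(0 <= t <oo) (a ^+ t)%:E * e t + (- (M / (1 - a)))%:E.
Proof.
move=> /andP[a0 a1] e0; apply/cvg_lim => //.
rewrite [X in X @ _ --> _](_ : _ = (fun n => \sum_(0 <= t < n) (a ^+ t)%:E * e t +
    (- series (geometric M a) n)%:E)); last first.
  apply/funext => n; rewrite !big_mkord sum_weighted_shift//.
  by rewrite /series /geometric /= big_mkord.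
apply: cvgeD.
- by rewrite fin_num_adde_defl.
- apply: is_cvg_nneseries => t _ _.
  by rewrite mule_ge0// lee_fin exprn_ge0.
- apply: cvg_EFin; first exact: nearW.
  apply: (@cvgN R R^o).
  by apply: cvg_geometric_series; rewrite ger0_norm.
Qed.

Lemma ereal_infD_cst (I : Type) (D : set I) (f g : I -> \bar R) (k : R) :
  (forall i, D i -> g i = f i + k%:E) ->
  ereal_inf (g @` D) = ereal_inf (f @` D) + k%:E.
Proof.
move=> gf; apply/eqP; rewrite eq_le; apply/andP; split.
  rewrite -leeBlDr//; apply: le_ereal_inf_tmp => _ [i Di <-]; rewrite leeBlDr// -gf//.
  by apply: ereal_inf_lbound; exists i.
apply: le_ereal_inf_tmp => _ [i Di <-]; rewrite gf//; apply: leeD2r.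
by apply: ereal_inf_lbound; exists i.
Qed.

End sums.

Section shift.
Context (R : realType) (dX dA : measure_display).
Context (X : measurableMetricType R dX) (A : measurableMetricType R dA).
Variables (q : R.-pker (X * A)%type ~> X) (c : X * A -> \bar R) (M : R).
Hypothesis mc : measurable_fun setT c.
Hypothesis M0 : (0 <= M)%R.

Definition shifted_cost (z : X * A) : \bar R := c z + M%:E.
Local Notation c' := shifted_cost.

Hypothesis c0 : forall z, 0 <= c' z.

Lemma shifted_costK z : c z = c' z + (- M)%:E.
Proof. by rewrite /shifted_cost -addeA -EFinD subrr adde0. Qed.

Lemma measurable_shifted_cost : measurable_fun setT c'.
Proof. exact: emeasurable_funD. Qed.

Lemma K_inf_compact_shifted_cost : K_inf_compact c -> K_inf_compact c'.
Proof.
move=> Kc K K0 cK r; rewrite (_ : [set s | c' s <= r%:E] = [set s | c s <= (r - M)%:E]).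
  exact: Kc.
by apply/seteqP; split => z /=; rewrite /shifted_cost EFinB leeBrDr.
Qed.

Let mct (a : R) t : measurable_fun setT (fun om : trajectory X A => (a ^+ t)%:E * c' (om t)).
Proof.
apply: measurable_funeM.
exact: measurableT_comp measurable_shifted_cost (measurable_coordinate t).
Qed.

Let wc0 (a : R) t (om : trajectory X A) : (0 <= a)%R -> 0 <= (a ^+ t)%:E * c' (om t).
Proof. by move=> a0; rewrite mule_ge0// lee_fin exprn_ge0. Qed.

Lemma cost_N_shift N (a : R) pi x : (0 <= a)%R ->
  cost_N c q N a pi x = cost_N c' q N a pi x + (- (\sum_(t < N) M * a ^+ t)%R)%:E.
Proof.
move=> a0; rewrite /cost_N.
have E (om : trajectory X A) : \sum_(t < N) (a ^+ t)%:E * c (om t) =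
    \sum_(t < N) (a ^+ t)%:E * c' (om t) + (- (\sum_(t < N) M * a ^+ t)%R)%:E.
  rewrite -(sum_weighted_shift _ _ a0 (fun t => c0 (om t))).
  by apply: eq_bigr => t _; rewrite -shifted_costK.
under eq_integral do rewrite E.
rewrite integralD_cst_probability//.
- by apply: sumr_ge0 => t _; rewrite mulr_ge0// exprn_ge0.
- by apply: emeasurable_sum => t.
- by move=> om; apply: sume_ge0 => t _; exact: wc0.
Qed.

Lemma cost_disc_shift (a : R) pi x : (0 <= a < 1)%R ->
  cost_disc c q a pi x = cost_disc c' q a pi x + (- (M / (1 - a)))%:E.
Proof.
move=> a01; have /andP[a0 a1] := a01; rewrite /cost_disc.
have E (om : trajectory X A) : \sum_(0 <= t <oo) (a ^+ t)%:E * c (om t) =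
    \sum_(0 <= t <oo) (a ^+ t)%:E * c' (om t) + (- (M / (1 - a)))%:E.
  rewrite -(eseries_weighted_shift _ a01 (fun t => c0 (om t))).
  by apply: eq_eseriesr => t _; rewrite -shifted_costK.
under eq_integral do rewrite E.
rewrite integralD_cst_probability//.
- by rewrite divr_ge0// subr_ge0 ltW.
- by apply: ge0_emeasurable_sum => // t om _ _; exact: wc0.
- by move=> om; apply: nneseries_ge0 => t _ _; exact: wc0.
Qed.

Lemma value_disc_shift (a : R) x : (0 <= a < 1)%R ->
  value_disc c q a x = value_disc c' q a x + (- (M / (1 - a)))%:E.
Proof. by move=> a01; apply: ereal_infD_cst => pi _; exact: cost_disc_shift. Qed.

Lemma m_disc_shift (a : R) : (0 <= a < 1)%R ->
  m_disc c q a = m_disc c' q a + (- (M / (1 - a)))%:E.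
Proof. by move=> a01; apply: ereal_infD_cst => x _; exact: value_disc_shift. Qed.

Lemma u_disc_shift (a : R) x : (0 <= a < 1)%R -> u_disc c q a x = u_disc c' q a x.
Proof.
move=> a01; rewrite /u_disc (value_disc_shift x a01) (m_disc_shift a01).
move: (value_disc c' q a x) (m_disc c' q a) => [v| |] [m| |] //=.
by congr (_%:E); lra.
Qed.

Lemma cost_avg_shift pi x : cost_avg c q pi x = cost_avg c' q pi x + (- M)%:E.
Proof.
rewrite /cost_avg -[RHS]limf_esupD_cst; apply: eq_limf_esup.
exists 1%N => // N /= N1; rewrite cost_N_shift//.
have Npos : (0 < N%:R :> R)%R by rewrite ltr0n.
rewrite muleDr//; last by rewrite fin_num_adde_defl.
congr (_ + _); rewrite -EFinM; congr (_%:E).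
under eq_bigr do rewrite expr1n mulr1.
by rewrite sumr_const card_ord -(mulr_natr M) mulrN mulrCA mulVf ?gt_eqF// mulr1.
Qed.

Lemma value_avg_shift x : value_avg c q x = value_avg c' q x + (- M)%:E.
Proof. by apply: ereal_infD_cst => pi _; exact: cost_avg_shift. Qed.

Lemma w_star_shift : w_star c q = w_star c' q + (- M)%:E.
Proof. by apply: ereal_infD_cst => x _; exact: value_avg_shift. Qed.

Let scaled_shift (a : R) (v : \bar R) : (0 <= a < 1)%R ->
  (1 - a)%:E * (v + (- (M / (1 - a)))%:E) = (1 - a)%:E * v + (- M)%:E.
Proof.
move=> /andP[_ a1]; rewrite muleDr//; last by rewrite fin_num_adde_defl.
congr (_ + _); rewrite -EFinM; congr (_%:E).
by rewrite mulrN mulrC divfK// gt_eqF// subr_gt0.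
Qed.

Let Filter_left : Filter ((1%R : R)^'-).
Proof. exact: at_left_proper_filter. Qed.

Lemma limsup_value_disc_shift x :
  limf_esup (fun a : R => (1 - a)%:E * value_disc c q a x) (1%R : R)^'- =
  limf_esup (fun a : R => (1 - a)%:E * value_disc c' q a x) (1%R : R)^'- + (- M)%:E.
Proof.
rewrite -limf_esupD_cst; apply: eq_limf_esup; near=> a.
have a01 : (0 <= a < 1)%R by near: a; exact: near_left1_range.
by rewrite value_disc_shift// scaled_shift.
Unshelve. all: by end_near. Qed.

Lemma w_bar_shift : w_bar c q = w_bar c' q + (- M)%:E.
Proof.
rewrite /w_bar -limf_esupD_cst; apply: eq_limf_esup; near=> a.
have a01 : (0 <= a < 1)%R by near: a; exact: near_left1_range.
by rewrite m_disc_shift// scaled_shift.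
Unshelve. all: by end_near. Qed.

Section sequence.
Variable alpha : nat -> R.
Hypothesis alpha_range : forall n, (0 <= alpha n < 1)%R.

Lemma limsup_value_disc_seq_shift x :
  limn_esup (fun n => (1 - alpha n)%:E * value_disc c q (alpha n) x) =
  limn_esup (fun n => (1 - alpha n)%:E * value_disc c' q (alpha n) x) + (- M)%:E.
Proof.
rewrite -[RHS]limf_esupD_cst; apply: eq_limf_esup; apply: nearW => n.
by rewrite value_disc_shift// scaled_shift.
Qed.

Lemma w_bar_seq_shift : w_bar_seq c q alpha = w_bar_seq c' q alpha + (- M)%:E.
Proof.
rewrite /w_bar_seq -[RHS]limf_esupD_cst; apply: eq_limf_esup; apply: nearW => n.
by rewrite m_disc_shift// scaled_shift.
Qed.

Lemma u_disc_seq_shift : (fun n => u_disc c q (alpha n)) = (fun n => u_disc c' q (alpha n)).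
Proof. by apply/funext => n; apply/funext => x; exact: u_disc_shift. Qed.

End sequence.
End shift.

Theorem theorem3p2 (R : realType) (dX dA : measure_display)
    (X : measurableMetricType R dX) (A : measurableMetricType R dA)
    (c : X * A -> \bar R) (q : R.-pker (X * A)%type ~> X) (alpha : nat -> R)
    (X_borel : borel_subset_of_polish X) (A_borel : borel_subset_of_polish A)
    (c_measurable : measurable_fun [set: X * A] c)
    (c_bounded_below : exists r : R, forall z, r%:E <= c z)
    (c_inf_compact : K_inf_compact c)
    (q_weakly_continuous : weakly_continuous q)
    (alpha_range : forall n, (0 <= alpha n < 1)%R)
    (alpha_nondecreasing : nondecreasing_seq alpha)
    (alpha_cvg : alpha n @[n --> \oo] --> (1 : R)%R)
    (w_star_lty : w_star c q < +oo)
    (u_liminf_lty : forall x, limn_einf (fun n => u_disc c q (alpha n) x) < +oo) :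
  let u := u_lim c q alpha in
  exists phi : {mfun X >-> A},
    [/\ (forall x, c (x, phi x) + \int[q (x, phi x)]_y u y <= w_bar c q + u x),
        average_optimal c q (det_policy phi),
        lower_semicontinuous u
      & forall x,
          value_avg c q x = cost_avg c q (det_policy phi) x /\
          cost_avg c q (det_policy phi) x =
            limn_esup (fun n => (1 - alpha n)%:E * value_disc c q (alpha n) x) /\
          limn_esup (fun n => (1 - alpha n)%:E * value_disc c q (alpha n) x) =
            limf_esup (fun a : R => (1 - a)%:E * value_disc c q a x) (1%R : R)^'- /\
          limf_esup (fun a : R => (1 - a)%:E * value_disc c q a x) (1%R : R)^'- =
            w_bar c q /\
          w_bar c q = w_bar_seq c q alpha /\
          w_bar_seq c q alpha = w_star c q].
Proof.
have [r cr] := c_bounded_below; pose M : R := `|r|%R.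
have M0 : (0 <= M)%R by exact: normr_ge0.
have c0 z : 0 <= shifted_cost c M z.
  apply: (@le_trans _ _ (r%:E + M%:E)); last exact: leeD2r.
  by rewrite -EFinD lee_fin -lerBlDl sub0r /M -normrN ler_norm.
have mX : (measurable : set (set X)) = <<s open >> by case: X_borel.
have lty_shift (a b : \bar R) : a = b + (- M)%:E -> a < +oo -> b < +oo.
  by move=> ->; case: b => [b| |] //= _; rewrite ltry.
have eq_shift (a b a' b' : \bar R) :
    a = a' + (- M)%:E -> b = b' + (- M)%:E -> a' = b' -> a = b.
  by move=> -> -> ->.
have le_shift (x y z w w' s : \bar R) :
    x = y + (- M)%:E -> w = w' + (- M)%:E -> y + z <= w' + s -> x + z <= w + s.
  move=> -> -> yw; rewrite addeAC (addeAC w'); exact: leeD2r.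
have w_shift := w_star_shift q c_measurable M0 c0.
have wb_shift := w_bar_shift q c_measurable M0 c0.
have u_shift := u_disc_seq_shift q c_measurable M0 c0 alpha_range.
have u_lty x : limn_einf (fun n => u_disc (shifted_cost c M) q (alpha n) x) < +oo.
  exact: (eq_ind _ (fun f => limn_einf (fun n => f n x) < +oo) (u_liminf_lty x) _ u_shift).
have [phi [acoi ulsc eqs]] := average_cost_optimality_nonneg mX A_borel
  (measurable_shifted_cost M c_measurable) c0 (K_inf_compact_shifted_cost c_inf_compact)
  q_weakly_continuous alpha_range alpha_cvg (lty_shift _ _ w_shift w_star_lty) u_lty.
have uE : u_lim (shifted_cost c M) q alpha = u_lim c q alpha.
  exact: (congr1 (fun f => liminf_nbhs f) (esym u_shift)).
rewrite uE in acoi ulsc.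
have eqs' x : [/\ value_avg c q x = w_star c q,
    cost_avg c q (det_policy phi) x = w_star c q,
    limn_esup (fun n => (1 - alpha n)%:E * value_disc c q (alpha n) x) = w_star c q,
    limf_esup (fun a : R => (1 - a)%:E * value_disc c q a x) (1%R : R)^'- = w_star c q
    & w_bar c q = w_star c q /\ w_bar_seq c q alpha = w_star c q].
  have [e1 e2 e3 e4 [e5 e6]] := eqs x; split.
  - exact: (eq_shift _ _ _ _ (value_avg_shift q c_measurable M0 c0 x) w_shift e1).
  - exact: (eq_shift _ _ _ _ (cost_avg_shift q c_measurable M0 c0 _ x) w_shift e2).
  - exact: (eq_shift _ _ _ _
      (limsup_value_disc_seq_shift q c_measurable M0 c0 alpha_range x) w_shift e3).
  - exact: (eq_shift _ _ _ _ (limsup_value_disc_shift q c_measurable M0 c0 x) w_shift e4).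
  - split; first exact: (eq_shift _ _ _ _ wb_shift w_shift e5).
    exact: (eq_shift _ _ _ _
      (w_bar_seq_shift q c_measurable M0 c0 alpha_range) w_shift e6).
move=> u; exists phi; split.
- move=> x; exact: (le_shift _ _ _ _ _ _ (shifted_costK c M _) wb_shift (acoi x)).
- by move=> x; have [e1 e2 _ _ _] := eqs' x; exact: (etrans e2 (esym e1)).
- exact: ulsc.
- move=> x; have [e1 e2 e3 e4 [e5 e6]] := eqs' x.
  split; first exact: (etrans e1 (esym e2)).
  split; first exact: (etrans e2 (esym e3)).
  split; first exact: (etrans e3 (esym e4)).
  split; first exact: (etrans e4 (esym e5)).
  by split; first exact: (etrans e5 (esym e6)).
Qed.
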